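(* Let $\kappa>0$ be a constant independent of $N$, and for each $N$ let $H_N$ be a random $N\times N$ real symmetric matrix. Assume: (W) There is a sequence of probability measures $(\mu_N)$ on $\mathbb{R}$ such that ${\rm W}_1(\mathbb{E}\hat\mu_{H_N},\mu_N)\le N^{-\kappa}$; the $\mu_N$'s are supported in a common compact set; and each $\mu_N$ has a density $\mu_N(\cdot)$ in the neighborhood $(-\kappa,\kappa)$ of $0$ which satisfies $\mu_N(x)<\kappa^{-1}|x|^{-1+\kappa}$ for all $|x|<\kappa$ and all $N$. (L) There exists $\epsilon_0>0$ with the following property: for every $\zeta>0$ there exists $c_\zeta>0$ such that, whenever $f:\mathbb{R}\to\mathbb{R}$ is Lipschitz, for every $\delta>0$, $$\mathbb{P}\left(\left|\frac1N\mathrm{Tr}(f(H_N))-\frac1N\mathbb{E}[\mathrm{Tr}(f(H_N))]\right|>\delta\right)\le\exp\left(-\frac{c_\zeta}{N^\zeta}\min\left\{\left(\frac{N\delta}{\|f\|_{\mathrm{Lip}}}\right)^2,\left(\frac{N\delta}{\|f\|_{\mathrm{Lip}}}\right)^{1+\epsilon_0}\right\}\right).$$ (Gap) For every $\epsilon>0$, $\lim_{N\to\infty}\mathbb{P}(H_N\text{ has no eigenvalues in }[-e^{-N^\epsilon},e^{-N^\epsilon}])=1$. Then $$\lim_{N\to\infty}\left(\frac1N\log\mathbb{E}[|\det(H_N)|]-\int_{\mathbb{R}}\log|\lambda|\,\mu_N(d\lambda)\right)=0.$$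
   Context: For a symmetric $N\times N$ matrix $T$ with eigenvalues $\lambda_i(T)$, $\hat\mu_T=\frac1N\sum_{i=1}^N\delta_{\lambda_i(T)}$; $\mathbb{E}\hat\mu_T$ is the averaged measure when $T$ is random. $\|f\|_{\mathrm{Lip}}$ is the Lipschitz constant of $f$. ${\rm W}_1(\mu,\nu)=\sup\{|\int f\,d(\mu-\nu)|:\|f\|_{\mathrm{Lip}}\le1\}$. *)

(* Defs.v *)
From HB Require Import structures.
From mathcomp Require Import all_boot all_order all_algebra.
From mathcomp Require Import polyrcf.
From mathcomp Require Import all_classical all_reals all_analysis.

Set Implicit Arguments.
Unset Strict Implicit.
Unset Printing Implicit Defensive.

Import Order.TTheory GRing.Theory Num.Theory.
Import numFieldNormedType.Exports.

Local Open Scope classical_set_scope.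
Local Open Scope ring_scope.
Local Open Scope ereal_scope.

(* The real eigenvalues of A in increasing order, repeated according to their
   algebraic multiplicity; there are N of them when A is symmetric. *)
Definition eigenvalues (R : realType) (N : nat) (A : 'M[R]_N) : seq R :=
  flatten [seq nseq (mup x (char_poly A)) x | x <- rootsR (char_poly A)].

(* (1/N) \sum_(i < N) \delta_(lambda_i(A)) *)
Definition esd (R : realType) (N : nat) (A : 'M[R]_N) :
    {measure set (measurableTypeR R) -> \bar R} :=
  mscale ((N%:R^-1)%:nng)%R
    (msum (fun i => \d_(nth 0%R (eigenvalues A) i : measurableTypeR R)) N).

(* B |-> E[esd (H w) B] *)
Definition mean_esd (R : realType) (d : measure_display) (T : measurableType d)
    (P : probability T R) (N : nat) (H : T -> 'M[R]_N) :
    set (measurableTypeR R) -> \bar R :=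
  fun B => \int[P]_w esd (H w) B.

(* The spectral functional calculus: f(A) is the matrix acting as f(x) on the
   eigenspace of A for each eigenvalue x. It exists and is unique when A is
   diagonalizable, in particular when A is symmetric; 0 is a dummy value. *)
Definition fun_mx (R : realType) (f : R -> R) (N : nat) (A : 'M[R]_N) :
    'M[R]_N :=
  xget 0%R [set B : 'M[R]_N |
    forall (x : R) (v : 'rV[R]_N), v *m A = (x *: v)%R -> v *m B = (f x *: v)%R].

(* The best Lipschitz constant of f, +oo when f is not Lipschitz. *)
Definition lip_norm (R : realType) (f : R -> R) : \bar R :=
  ereal_sup [set (`|f z.1 - f z.2| / `|z.1 - z.2|)%:E | z in
    [set z : R * R | z.1 != z.2]].

(* mu and nu are only required to be set functions, so that W1 applies to
   mean_esd. *)
Definition W1 (R : realType) (mu nu : set (measurableTypeR R) -> \bar R) :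
    \bar R :=
  ereal_sup [set `| \int[mu]_x (f x)%:E - \int[nu]_x (f x)%:E | | f in
    [set f : R -> R | lip_norm f <= 1]].

(* Main.v *)
Require Import Defs.
From HB Require Import structures.
From mathcomp Require Import all_boot all_order all_algebra.
From mathcomp Require Import complex polyrcf.
From mathcomp Require Import all_classical all_reals all_analysis.
From mathcomp Require Import measurable_realfun.
From mathcomp Require Import ring lra.

Set Implicit Arguments.
Unset Strict Implicit.
Unset Printing Implicit Defensive.

Import Order.TTheory GRing.Theory Num.Theory.
Import numFieldNormedType.Exports.

Local Open Scope classical_set_scope.
Local Open Scope ring_scope.

(** The logarithm of |det H| is the sum of the log |lambda_i|, a linear statistic of
    the eigenvalues, and the normalised mean of a linear statistic is close to its
    integral against mu_N by the Wasserstein hypothesis.  The logarithm is not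
    Lipschitz at the origin, so it is cut off at the scale eta = N^(-a), with a
    small: [log_plus eta] is log(|x|/eta) for |x| >= eta and 0 below.  This is
    nonnegative and 1/eta-Lipschitz, and log |x| <= log_plus eta x + log eta.

    Upper bound.  |det H| <= exp (Tr (log_plus eta) (H) + N log eta).  For a small,
    the concentration hypothesis gives the tail exp (-2t) for the fluctuation of
    this trace at every t >= sqrt N ([tail_exponent]), so the exponential moment of
    the fluctuation is exp (O (sqrt N)) ([exponential_moment_le]), which is
    negligible after taking log and dividing by N.

    Lower bound.  The cut-off only matters for the eigenvalues in [-eta, eta].
    On the gap event each of them has log |lambda| >= - N^eps, and their number is
    at most the trace of a [tent], which is again a Lipschitz statistic.  Its
    normalised mean is bounded by a negative power of N, because mu_N gives mass
    O (eta^p) to such an interval; for eps small, N^eps times this bound tends to 0, and Markov's inequality keeps it small with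
    probability bounded below.  So E |det H| is at least a constant times the
    exponential of the expected truncated statistic ([expected_det_ge]).

    Deterministic error.  The density bound gives mu_N (-s, s) = O (s^p), with
    p = min (kappa, 1), by cutting the interval into dyadic shells; the same
    decomposition bounds the integral of log (eta/|x|) over (-eta, eta) by
    O (eta^p) ([density_ball], [log_deficit]).  All errors are negative powers of
    N, collected in [rate].

    Two facts make these computations legitimate.  A real symmetric matrix is
    diagonalizable, so traces of functions of it are sums over its eigenvalues.
    The eigenvalue counts are measurable functions of the matrix entries
    ([measurable_esd]), so the mean spectral distribution is a composition of
    kernels, against which integrals are expectations of linear statistics
    ([ge0_integral_mean_esd]). *)

(** * Real symmetric matrices *)

(** Over the complex numbers the matrix is Hermitian, hence has a real diagonal
    form. Its minimal polynomial is therefore a product of distinct real linear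
    factors; it is unchanged by extension of scalars, so the matrix is already
    diagonalizable over the reals. *)
Lemma symmetric_diagonalizable (R : realType) (n : nat) (A : 'M[R]_n) :
  A^T = A -> exists (Q : 'M[R]_n) (D : 'rV[R]_n),
    Q \in unitmx /\ A = invmx Q *m diag_mx D *m Q.
Proof.
case: n A => [|n] A sA.
  by exists 1%:M, 0; rewrite unitmx1; split=> //; apply/matrixP => -[].
have [sym real] : map_mx (real_complex R) A \is symmetricmx /\
    map_mx (real_complex R) A \is a mxOver Num.real.
  split; first apply/is_hermitianmxP.
    by rewrite expr0 scale1r map_mx_id// map_trmx sA.
  by apply/mxOverP => i j; rewrite mxE complex_real.
have herm := realsym_hermsym sym real.
have /orthomx_spectralP AE := hermitian_normalmx herm.
have /mxOverP Dreal := hermitian_spectral_diag_real herm.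
set Q := spectralmx _ in AE; set D := spectral_diag _ in AE Dreal.
have Qu : Q \in unitmx by exact: spectral_unit.
have : diagonalizable A.
  apply/diagonalizableP; exists (undup [seq complex.Re (D 0 i) | i <- enum 'I_n.+1]).
    exact: undup_uniq.
  rewrite -(dvdp_map (real_complex R)) -mxminpoly_map.
  rewrite AE -conjVmx// mxminpoly_uconj ?unitmx_inv// mxminpoly_diag.
  rewrite rmorph_prod.
  under [X in _ %| X]eq_bigr => r _ do rewrite rmorphB /= map_polyX map_polyC.
  rewrite -(big_map (real_complex R) xpredT (fun x => 'X - x%:P)).
  rewrite -undup_map_inj; last exact: complexI.
  have -> // : [seq real_complex R i | i <- [seq complex.Re (D 0 i) | i <- enum 'I_n.+1]] =
      [seq D 0 i | i <- enum 'I_n.+1].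
  by rewrite -map_comp; apply: eq_map => i /=; rewrite RRe_real.
case=> P Pu /(diagonalizable_forLR Pu)[D' ->].
by exists P, D'; split=> //; exact: conjVmx.
Qed.

Lemma count_eigenvalues (R : realType) (n : nat) (A : 'M[R]_n) x :
  count_mem x (eigenvalues A) = mup x (char_poly A).
Proof.
have p0 : char_poly A != 0 by exact/monic_neq0/char_poly_monic.
rewrite /eigenvalues; have := roots_on_rootsR p0.
move=> /roots_onP /(_ x); rewrite inE /= => /(_ isT) rx.
have : uniq (rootsR (char_poly A)) by exact: uniq_roots.
rewrite count_flatten -map_comp.
under eq_map => y do rewrite /= count_nseq.
have [rx1|rx1] := boolP (root (char_poly A) x); last first.
  rewrite mupNroot// => _; rewrite sumnE big_map big1_seq// => y /= yr.
  by case: eqP => // yx; move: rx1; rewrite rx -yx yr.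
have {rx1}xr : x \in rootsR (char_poly A) by rewrite -rx.
move=> u; rewrite sumnE big_map (bigD1_seq x)//= eqxx mul1n big1 ?addn0// => y.
by rewrite eq_sym; case: eqVneq.
Qed.

Lemma mup_prod_XsubC (R : realType) (s : seq R) x :
  mup x (\prod_(a <- s) ('X - a%:P)) = count_mem x s.
Proof.
elim: s => [|a s IH]; first by rewrite big_nil mupNroot// root1.
rewrite big_cons mupM ?polyXsubC_eq0 ?IH//=.
  by rewrite -['X - a%:P]expr1 mup_XsubCX; case: eqP.
by rewrite monic_neq0// monic_prod_XsubC.
Qed.

Lemma char_poly_conj (R : realType) (n : nat) (Q B : 'M[R]_n) :
  Q \in unitmx -> char_poly (invmx Q *m B *m Q) = char_poly B.
Proof.
move=> Qu; rewrite /char_poly /char_poly_mx !map_mxM.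
have qq : map_mx polyC (invmx Q) *m map_mx polyC Q = 1%:M.
  by rewrite -map_mxM mulVmx// map_mx1.
rewrite (_ : _ - _ = map_mx polyC (invmx Q) *m ('X%:M - map_mx polyC B) *m
    map_mx polyC Q); last first.
  by rewrite mulmxBr mulmxBl mul_mx_scalar -scalemxAl qq scalemx1.
by rewrite !det_mulmx mulrAC -det_mulmx qq det1 mul1r.
Qed.

Lemma perm_eigenvalues (R : realType) (n : nat) (Q : 'M[R]_n) (D : 'rV[R]_n) :
  Q \in unitmx ->
  perm_eq (eigenvalues (invmx Q *m diag_mx D *m Q)) [seq D 0 i | i <- enum 'I_n].
Proof.
move=> Qu; apply/allP => x _ /=.
rewrite count_eigenvalues -mup_prod_XsubC big_map.
rewrite char_poly_conj// char_poly_trig ?diag_mx_is_trig//.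
apply/eqP; congr (mup x _); rewrite big_enum/=; apply: eq_bigr => i _.
by rewrite mxE eqxx.
Qed.

(** The rows of Q are eigenvectors that span the space, which pins down any matrix
    acting on the eigenspaces as f prescribes. *)
Lemma fun_mxE (R : realType) (n : nat) (Q : 'M[R]_n) (D : 'rV[R]_n) (f : R -> R) :
  Q \in unitmx ->
  fun_mx f (invmx Q *m diag_mx D *m Q) = invmx Q *m diag_mx (map_mx f D) *m Q.
Proof.
move=> Qu; rewrite /fun_mx; set S := [set B | _].
have SE : S = [set invmx Q *m diag_mx (map_mx f D) *m Q].
  apply/seteqP; split=> [B SB|B ->] /=.
    apply: (can_inj (mulKmx Qu)); rewrite !mulmxA mulmxV// mul1mx.
    apply/row_matrixP => i; rewrite !row_mul.
    rewrite (SB (D 0 i)); first by rewrite row_diag_mx mxE -scalemxAl -rowE.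
    by rewrite -row_mul !mulmxA mulmxV// mul1mx row_mul row_diag_mx -scalemxAl -rowE.
  move=> x v vE; rewrite -[v](mulmxKV Qu); set u := v *m invmx Q.
  have uE : u *m diag_mx D = x *: u.
    by rewrite /u scalemxAl -vE !mulmxA mulmxK.
  rewrite !mulmxA mulmxK// scalemxAl.
  suff -> : u *m diag_mx (map_mx f D) = f x *: u by [].
  clearbody u; apply/rowP => i.
  move/rowP : uE => /(_ i); rewrite !mul_mx_diag !mxE => uE.
  have [u0|u0] := eqVneq (u 0 i) 0; first by rewrite u0 mul0r mulr0.
  by rewrite mulrC; congr (f _ * _); apply: (mulIf u0); rewrite mulrC.
by rewrite SE; case: xgetP => [B _ ->//|/(_ _ erefl)].
Qed.

Section FunctionalCalculus.
Variables (R : realType) (n : nat) (A : 'M[R]_n).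
Hypothesis symA : A^T = A.

Lemma fun_mx_cst (c : R) : fun_mx (fun=> c) A = c%:M.
Proof.
have [Q [D [Qu ->]]] := symmetric_diagonalizable symA.
rewrite fun_mxE// (_ : map_mx _ D = const_mx c).
  by rewrite diag_const_mx mul_mx_scalar -scalemxAl mulVmx// scalemx1.
by apply/rowP => i; rewrite !mxE.
Qed.

Lemma fun_mx_id : fun_mx id A = A.
Proof.
have [Q [D [Qu AE]]] := symmetric_diagonalizable symA.
by rewrite AE fun_mxE// map_mx_id.
Qed.

Lemma fun_mxD (f g : R -> R) : fun_mx (f \+ g) A = fun_mx f A + fun_mx g A.
Proof.
have [Q [D [Qu ->]]] := symmetric_diagonalizable symA.
rewrite !fun_mxE// -mulmxDl -mulmxDr -raddfD; congr (_ *m diag_mx _ *m _).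
by apply/rowP => i; rewrite !mxE.
Qed.

Lemma fun_mxM (f g : R -> R) : fun_mx (f \* g) A = fun_mx f A *m fun_mx g A.
Proof.
have [Q [D [Qu ->]]] := symmetric_diagonalizable symA.
rewrite !fun_mxE// !mulmxA mulmxK// -[X in X *m Q]mulmxA mulmx_diag.
congr (_ *m diag_mx _ *m _).
by apply/rowP => i; rewrite !mxE.
Qed.

(** The diagonalizing basis does not depend on f, so that each entry is a fixed
    linear combination of finitely many values of f. *)
Lemma fun_mx_cvg (f_ : nat -> R -> R) (f : R -> R) i j :
  (forall x, f_ m x @[m --> \oo] --> f x) ->
  fun_mx (f_ m) A i j @[m --> \oo] --> fun_mx f A i j.
Proof.
move=> ff; have [Q [D [Qu ->]]] := symmetric_diagonalizable symA.
have E g : fun_mx g (invmx Q *m diag_mx D *m Q) i j =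
    \sum_k invmx Q i k * g (D 0 k) * Q k j.
  by rewrite fun_mxE// mxE; apply: eq_bigr => k _; rewrite mul_mx_diag !mxE.
rewrite E; under eq_fun do rewrite E.
apply: cvg_big => [|k _]; first exact: add_continuous.
by apply: cvgMr_tmp; apply: cvgMl_tmp.
Qed.

Lemma size_eigenvalues : size (eigenvalues A) = n.
Proof.
have [Q [D [Qu ->]]] := symmetric_diagonalizable symA.
by rewrite (perm_size (perm_eigenvalues _ Qu)) size_map size_enum_ord.
Qed.

Lemma trace_fun_mx (f : R -> R) :
  \tr (fun_mx f A) = \sum_(x <- eigenvalues A) f x.
Proof.
have [Q [D [Qu ->]]] := symmetric_diagonalizable symA.
rewrite fun_mxE// mxtrace_mulC mulmxA mulmxV// mul1mx mxtrace_diag.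
rewrite (perm_big _ (perm_eigenvalues _ Qu)) big_map big_enum /=.
by apply: eq_bigr => i _; rewrite mxE.
Qed.

Lemma det_eigenvalues : \det A = \prod_(x <- eigenvalues A) x.
Proof.
have [Q [D [Qu ->]]] := symmetric_diagonalizable symA.
rewrite !det_mulmx mulrAC -det_mulmx mulVmx// det1 mul1r det_diag.
by rewrite (perm_big _ (perm_eigenvalues _ Qu)) big_map big_enum.
Qed.

Lemma esdE (B : set (measurableTypeR R)) :
  esd A B = (n%:R^-1 * \tr (fun_mx \1_B A))%:E.
Proof.
rewrite /esd /mscale/= /msum/= trace_fun_mx EFinM.
congr (_ * _)%E; rewrite (big_nth 0) big_mkord size_eigenvalues -sumEFin.
by apply: eq_bigr.
Qed.

End FunctionalCalculus.

Lemma mem_eigenvalues (R : realType) (n : nat) (A : 'M[R]_n) (x : R) :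
  (x \in eigenvalues A) = eigenvalue A x.
Proof.
have p0 : char_poly A != 0 by exact/monic_neq0/char_poly_monic.
by rewrite eigenvalue_root_char -has_pred1 has_count count_eigenvalues
  -XsubC_dvd// dvdp_XsubCl.
Qed.

(** * Measurability of the spectrum *)

(** The functions f for which the entries of f(H) are measurable form an algebra,
    because the functional calculus is multiplicative, and are closed under
    pointwise limits. They contain the polynomials, hence the exponentials of their
    members, hence the indicators of rays, hence those of all Borel sets. No
    measurable choice of eigenvectors or ordering of eigenvalues is involved. *)
Section Measurability.
Variables (R : realType) (d : measure_display) (T : measurableType d) (n : nat).
Variable H : T -> 'M[R]_n.
Hypothesis mH : forall i j, measurable_fun [set: T] (fun w => H w i j).
Hypothesis symH : forall w, (H w)^T = H w.

Let calc (f : R -> R) :=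
  forall i j, measurable_fun [set: T] (fun w => fun_mx f (H w) i j).

Let calc_cst (c : R) : calc (fun=> c).
Proof. by move=> i j; under eq_fun do rewrite (fun_mx_cst (symH _)); exact: measurable_cst. Qed.

Let calc_id : calc id.
Proof. by move=> i j; under eq_fun do rewrite (fun_mx_id (symH _)); exact: mH. Qed.

Let calcD f g : calc f -> calc g -> calc (f \+ g).
Proof.
move=> cf cg i j; under eq_fun do rewrite (fun_mxD (symH _)) mxE.
exact: measurable_funD.
Qed.

Let calcM f g : calc f -> calc g -> calc (f \* g).
Proof.
move=> cf cg i j; under eq_fun do rewrite (fun_mxM (symH _)) mxE.
by apply: measurable_sum => k; apply: measurable_funM.
Qed.

Let calcX f m : calc f -> calc (fun x => f x ^+ m).
Proof.
move=> cf; elim: m => [|m IH]; first exact: calc_cst.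
rewrite (_ : (fun _ => _) = f \* (fun x => f x ^+ m)); first exact: calcM.
by apply/funext => x; rewrite /= exprS.
Qed.

Let calc_cvg (f_ : nat -> R -> R) f : (forall m, calc (f_ m)) ->
  (forall x, f_ m x @[m --> \oo] --> f x) -> calc f.
Proof.
move=> cf ff i j; apply: (measurable_fun_cvg (h := fun m w => fun_mx (f_ m) (H w) i j)).
  by move=> m; exact: cf.
by move=> w _; exact: fun_mx_cvg.
Qed.

Let calc_sum (f_ : nat -> R -> R) m : (forall k, calc (f_ k)) ->
  calc (fun x => \sum_(0 <= k < m) f_ k x).
Proof.
move=> cf; elim: m => [|m IH].
  by under eq_fun do rewrite big_nil; exact: calc_cst.
by under eq_fun do rewrite big_nat_recr//=; exact: calcD.
Qed.

Let calc_prod (f_ : nat -> R -> R) m : (forall k, calc (f_ k)) ->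
  calc (fun x => \prod_(0 <= k < m) f_ k x).
Proof.
move=> cf; elim: m => [|m IH].
  by under eq_fun do rewrite big_nil; exact: calc_cst.
by under eq_fun do rewrite big_nat_recr//=; exact: calcM.
Qed.

Let calc_expR f : calc f -> calc (fun x => expR (f x)).
Proof.
move=> cf; apply: (@calc_cvg (fun m x => \sum_(0 <= k < m) (f x ^+ k / k`!%:R))).
  by move=> m; apply: calc_sum => k; apply: calcM (calcX k cf) (calc_cst _).
move=> x; exact: is_cvg_series_exp_coeff.
Qed.

(* exp (- exp (m (x - t))) tends to 1, 1/e or 0 as x < t, x = t or x > t. The
   powers of this limit converge to the indicator of x < t. *)
Let step (t x : R) : R := if x < t then 1 else if x == t then expR (-1) else 0.

Let calc_step t : calc (step t).
Proof.
apply: (@calc_cvg (fun m x => expR (- 1 * expR (m%:R * (x + - t))))).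
  move=> m; apply: (@calc_expR (fun x => - 1 * expR (m%:R * (x + - t)))).
  apply: calcM (calc_cst _) _; apply: (@calc_expR (fun x => m%:R * (x + - t))).
  exact: calcM (calc_cst _) (calcD calc_id (calc_cst _)).
move=> x; rewrite /step; under eq_fun do rewrite mulN1r.
have [xt|tx|->] := ltgtP x t; last first.
- by rewrite subrr; under eq_fun do rewrite mulr0 expR0; exact: cvg_cst.
- have tx0 : 0 < x - t by rewrite subr_gt0.
  apply: (squeeze_cvgr (f := cst 0) (h := GRing.exp (expR (- (x - t))))).
  + near=> m; rewrite expR_ge0/= -expRM_natl ler_expR mulrN lerN2.
    by have := expR_ge1Dx (m%:R * (x - t)); lra.
  + exact: cvg_cst.
  + by apply: cvg_expr; rewrite ger0_norm ?expR_ge0// expR_lt1 oppr_lt0.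
- have xt0 : expR (m%:R * (x - t)) @[m --> \oo] --> 0.
    under eq_fun do rewrite expRM_natl.
    by apply: cvg_expr; rewrite ger0_norm ?expR_ge0// expR_lt1 subr_lt0.
  suff : expR (- expR (m%:R * (x - t))) @[m --> \oo] --> expR (- 0).
    by rewrite oppr0 expR0.
  apply: (@continuous_cvg _ _ _ _ _ _ (@expR R)); first exact: continuous_expR.
  exact: cvgN.
Unshelve. all: by end_near. Qed.

Let calc_ray t : calc \1_(`]-oo, t[%classic).
Proof.
apply: (@calc_cvg (fun m x => step t x ^+ m)); first by move=> m; exact: calcX.
move=> x; rewrite indicE mem_setE in_itv/= /step.
have [xt|tx|_] := ltgtP x t; last first.
- by apply: cvg_expr; rewrite ger0_norm ?expR_ge0// expR_lt1 oppr_lt0.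
- by apply: cvg_expr; rewrite normr0.
- by under eq_fun do rewrite expr1n; exact: cvg_cst.
Qed.

Let calc_indic (B : set (measurableTypeR R)) : measurable B -> calc \1_B.
Proof.
move=> mB; have : (@RGenInftyO.G R).-sigma.-measurable B.
  by rewrite -RGenInftyO.measurableE.
move: B {mB}; apply: smallest_sub.
- split.
  + by rewrite indic0; exact: calc_cst.
  + move=> A cA; rewrite (_ : \1_(_) = (fun=> 1) \+ ((fun=> -1) \* \1_A)).
      exact: calcD (calc_cst _) (calcM (calc_cst _) cA).
    by apply/funext => x; rewrite setTD /= !indicE in_setC; case: (x \in A) => /=; lra.
  (* A finite union is the complement of a product of complements. *)
  + move=> F cF; apply: (@calc_cvg (fun m x =>
        1 + (-1) * \prod_(0 <= k < m) (1 + (-1) * \1_(F k) x))).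
      move=> m; apply: calcD (calc_cst _) (calcM (calc_cst _) _).
      apply: calc_prod => k.
      exact: calcD (calc_cst _) (calcM (calc_cst _) (cF k)).
    move=> x; have [[k _ Fk]|nF] := pselect ((\bigcup_k F k) x).
      rewrite indicE mem_set; last by exists k.
      apply: cvg_near_cst; near=> m.
      rewrite (bigD1_seq k) ?iota_uniq //=; last first.
        rewrite mem_index_iota; near: m; by exists k.+1.
      by rewrite indicE mem_set// mulr1 subrr mul0r mulr0 addr0.
    rewrite indicE memNset//; apply: cvg_near_cst; near=> m.
    rewrite big1 ?mulr1 ?subrr// => k _; rewrite indicE memNset ?mulr0 ?addr0// => Fk.
    by apply: nF; exists k.
- by move=> _ [t ->]; exact: calc_ray.
Unshelve. all: by end_near. Qed.

Lemma measurable_esd (B : set (measurableTypeR R)) : measurable B ->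
  measurable_fun [set: T] (fun w => esd (H w) B).
Proof.
move=> mB; under eq_fun do rewrite (esdE (symH _)).
apply/measurable_EFinP; apply: measurable_funM => //.
by apply: measurable_sum => i; exact: calc_indic.
Qed.

End Measurability.

(** * The mean empirical spectral distribution *)

Lemma ge0_integral_esd (R : realType) (n : nat) (A : 'M[R]_n) (f : R -> R) :
  A^T = A -> measurable_fun [set: R] f -> (forall x, 0 <= f x) ->
  (\int[esd A]_x (f x)%:E = (n%:R^-1 * \tr (fun_mx f A))%:E)%E.
Proof.
move=> symA mf f0; rewrite /esd.
have mf' : measurable_fun [set: measurableTypeR R] (EFin \o f).
  exact/measurable_EFinP.
rewrite ge0_integral_mscale//=; last by move=> x _; rewrite lee_fin.
rewrite ge0_integral_measure_sum//; last by move=> x _; rewrite lee_fin.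
rewrite trace_fun_mx// EFinM; congr (_ * _)%E.
rewrite (big_nth 0) big_mkord size_eigenvalues// -sumEFin.
by apply: eq_bigr => i _; rewrite integral_dirac// diracT mul1e.
Qed.

Lemma esd_setT_le1 (R : realType) (n : nat) (A : 'M[R]_n) :
  A^T = A -> (esd A [set: measurableTypeR R] <= 1)%E.
Proof.
move=> symA; rewrite -[leLHS]mul1e -integral_cst//.
rewrite (eq_integral (EFin \o cst 1))// ge0_integral_esd//.
rewrite trace_fun_mx// big_const_seq count_predT size_eigenvalues//.
rewrite iter_addr_0 lee_fin; case: n A symA => [|n] A symA.
  by rewrite mulr0n mulr0.
by rewrite mulVf ?pnatr_eq0.
Qed.

(** Once the empirical spectral distribution is known to be a transition kernel,
    its mean is the composition of the law of the sample with that kernel, and the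
    integration formula for compositions of kernels applies to it. *)
Section SpectralKernel.
Variables (R : realType) (d : measure_display) (T : measurableType d).
Variables (P : probability T R) (n : nat) (H : T -> 'M[R]_n).
Hypothesis mH : forall i j, measurable_fun [set: T] (fun w => H w i j).
Hypothesis symH : forall w, (H w)^T = H w.

(** The proofs of measurability and symmetry are parameters, so that they can be
    recovered from the term when the kernel structure is inferred. The unit factor
    only matches the shape required by the composition of kernels. *)
Definition esd_kernel
    (mH : forall i j, measurable_fun [set: T] (fun w => H w i j))
    (symH : forall w, (H w)^T = H w)
    (p : unit * T) : {measure set (measurableTypeR R) -> \bar R} :=
  esd (H p.2).

Let measurable_esd_kernel (U : set (measurableTypeR R)) : measurable U ->
  measurable_fun [set: unit * T] (esd_kernel mH symH ^~ U).
Proof.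
move=> mU; change (measurable_fun setT ((fun w => esd (H w) U) \o @snd unit T)).
by apply: measurableT_comp measurable_snd; exact: measurable_esd.
Qed.

HB.instance Definition _ := isKernel.Build _ _ _ _ R (esd_kernel mH symH)
  measurable_esd_kernel.

Let esd_kernel_uub : measure_fam_uub (esd_kernel mH symH).
Proof.
exists 2%R => p; rewrite (le_lt_trans (esd_setT_le1 (symH _)))// lte_fin.
by rewrite ltr1n.
Qed.

HB.instance Definition _ :=
  Kernel_isFinite.Build _ _ _ _ R (esd_kernel mH symH) esd_kernel_uub.

Lemma ge0_integral_mean_esd (f : R -> R) :
  measurable_fun [set: R] f -> (forall x, 0 <= f x) ->
  (\int[mean_esd P H]_x (f x)%:E =
   \int[P]_w (n%:R^-1 * \tr (fun_mx f (H w)))%:E)%E.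
Proof.
move=> mf f0.
have mP : measurable_fun [set: unit] (fun _ : unit => (P : pprobability T R)).
  exact: measurable_cst.
have := @integral_kcomp _ _ _ _ _ _ R (kprobability mP) (esd_kernel mH symH) tt
  (EFin \o f).
move=> /(_ _ _)/wrap[z|//|E]; first by rewrite lee_fin.
  exact/measurable_EFinP.
transitivity (\int[P]_w \int[esd (H w)]_x (f x)%:E)%E; first exact: E.
by apply: eq_integral => w _; rewrite ge0_integral_esd.
Qed.

Lemma measurable_trace_fun_mx (f : R -> R) :
  measurable_fun [set: R] f -> (forall x, 0 <= f x) ->
  measurable_fun [set: T] (fun w => \tr (fun_mx f (H w))).
Proof.
move=> mf f0; have [n0|n0] := eqVneq n 0%N.
  rewrite (_ : (fun _ => _) = cst 0)//; apply/funext => w.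
  rewrite trace_fun_mx// (size0nil (s := eigenvalues _)) ?big_nil//.
  by rewrite size_eigenvalues.
rewrite (_ : (fun _ => _) = (fun w => n%:R * (n%:R^-1 * \tr (fun_mx f (H w))))).
  apply: measurable_funM => //; apply/measurable_EFinP.
  rewrite (_ : _ \o _ = (fun w => \int[esd (H w)]_x (f x)%:E)%E).
    apply: measurable_fun_integral_kernel.
    + by move=> U mU; exact: measurable_esd.
    + by move=> x; rewrite lee_fin.
    + exact/measurable_EFinP.
  by apply/funext => w; rewrite ge0_integral_esd.
by apply/funext => w; rewrite mulrA mulfV ?mul1r// pnatr_eq0.
Qed.

End SpectralKernel.

(** * Statistics of Lipschitz functions *)

Lemma lip_norm_le (R : realType) (f : R -> R) (l : R) :
  (forall x y, `|f x - f y| <= l * `|x - y|) -> (lip_norm f <= l%:E)%E.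
Proof.
move=> fl; apply: ge_ereal_sup => _ [[x y] /= xy <-].
by rewrite lee_fin ler_pdivrMr// normr_gt0 subr_eq0.
Qed.

Lemma lip_norm_gt0 (R : realType) (f : R -> R) (x y : R) :
  f x != f y -> (0 < lip_norm f)%E.
Proof.
move=> fxy; apply: (@lt_le_trans _ _ (`|f x - f y| / `|x - y|)%:E).
  have xy : x != y by apply: contra_neq fxy => ->.
  by rewrite lte_fin divr_gt0// normr_gt0 subr_eq0.
apply: ereal_sup_ubound; exists (x, y) => //=.
by apply: contra_neq fxy => ->.
Qed.

Lemma lipschitz_measurable (R : realType) (f : R -> R) (l : R) :
  (forall x y, `|f x - f y| <= l * `|x - y|) -> measurable_fun [set: R] f.
Proof.
move=> fl; apply: continuous_measurable_fun => x.
have l0 : 0 <= l.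
  by have := fl 1 0; rewrite subr0 normr1 mulr1; apply: le_trans.
apply/cvgrPdist_lt => e e0; near=> y.
rewrite (le_lt_trans (fl _ _))//.
rewrite (@le_lt_trans _ _ ((l + 1) * `|x - y|))// ?ler_wpM2r ?lerDl//.
rewrite mulrC -ltr_pdivlMr; last by rewrite ltr_wpDl.
by near: y; apply: cvgr_dist_lt => //; rewrite divr_gt0// ltr_wpDl.
Unshelve. all: by end_near. Qed.

(** Only nonnegative test functions are needed. For them every integral makes
    sense in the extended reals, and integrability of the statistic is a
    consequence of the distance bound rather than a hypothesis. *)
Section LinearStatistics.
Variables (R : realType) (d : measure_display) (T : measurableType d).
Variables (P : probability T R) (n : nat) (H : T -> 'M[R]_n).
Hypothesis mH : forall i j, measurable_fun [set: T] (fun w => H w i j).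
Hypothesis symH : forall w, (H w)^T = H w.
Variables (f : R -> R) (l : R).
Hypothesis f_ge0 : forall x, 0 <= f x.
Hypothesis l_gt0 : 0 < l.
Hypothesis f_lip : forall x y, `|f x - f y| <= l * `|x - y|.

Local Notation S := (fun w => n%:R^-1 * \tr (fun_mx f (H w))).

Lemma trace_fun_mx_ge0 w : 0 <= \tr (fun_mx f (H w)).
Proof. by rewrite trace_fun_mx// sumr_ge0. Qed.

Lemma measurable_lipschitz_stat : measurable_fun [set: T] S.
Proof.
apply: measurable_funM => //; apply: measurable_trace_fun_mx => //.
exact: lipschitz_measurable f_lip.
Qed.

(** Apply the supremum that defines the distance to f / l. If the statistic had
    infinite mean, the distance would be infinite too. *)
Lemma lipschitz_stat_W1 (mu : probability (measurableTypeR R) R) (r : R) :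
  (W1 (mean_esd P H) mu <= r%:E)%E ->
  (\int[mu]_x (f x)%:E < +oo)%E ->
  (\int[P]_w (S w)%:E <= \int[mu]_x (f x)%:E + (l * r)%:E /\
   \int[mu]_x (f x)%:E <= \int[P]_w (S w)%:E + (l * r)%:E)%E.
Proof.
move=> W1r ify; have mf : measurable_fun [set: R] f.
  exact: lipschitz_measurable f_lip.
have l0 := ltW l_gt0.
have g0 x : 0 <= l^-1 * f x by rewrite mulr_ge0// invr_ge0.
have mg : measurable_fun [set: R] (fun x => l^-1 * f x).
  by apply: measurable_funM.
have glip : (lip_norm (fun x => (l^-1 * f x)%R) <= 1)%E.
  apply: lip_norm_le => x y; rewrite -mulrBr normrM gtr0_norm ?invr_gt0// mul1r.
  by rewrite ler_pdivrMl.
have : (`|\int[mean_esd P H]_x (l^-1 * f x)%:E - \int[mu]_x (l^-1 * f x)%:E| <= r%:E)%E.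
  by apply: le_trans W1r; apply: ereal_sup_ubound; exists (fun x => l^-1 * f x).
rewrite (ge0_integral_mean_esd _ mH symH mg g0).
have -> : (\int[P]_w (n%:R^-1 * \tr (fun_mx (fun x => l^-1 * f x) (H w)))%:E =
    l^-1%:E * \int[P]_w (S w)%:E)%E.
  rewrite -ge0_integralZl_EFin ?invr_ge0//; last 2 first.
  - by move=> w _; rewrite lee_fin mulr_ge0 ?invr_ge0// trace_fun_mx_ge0.
  - by apply/measurable_EFinP; exact: measurable_lipschitz_stat.
  apply: eq_integral => w _; rewrite -EFinM; congr EFin.
  by rewrite !trace_fun_mx// -mulr_sumr mulrCA.
have -> : (\int[mu]_x (l^-1 * f x)%:E = l^-1%:E * \int[mu]_x (f x)%:E)%E.
  rewrite -ge0_integralZl_EFin ?invr_ge0//.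
  - by move=> w _; rewrite lee_fin.
  - exact/measurable_EFinP.
have : (0 <= \int[P]_w (S w)%:E)%E.
  by apply: integral_ge0 => w _; rewrite lee_fin mulr_ge0 ?invr_ge0// trace_fun_mx_ge0.
have : (0 <= \int[mu]_x (f x)%:E)%E by apply: integral_ge0 => w _; rewrite lee_fin.
move: ify; case: (\int[mu]_x _)%E => [b| |]//= _ _.
case: (\int[P]_w _)%E => [a| |]//= _.
  rewrite !lee_fin -mulrBr normrM gtr0_norm ?invr_gt0//.
  rewrite ler_pdivrMl// ler_norml => /andP[]; lra.
by rewrite gt0_muley ?lte_fin ?invr_gt0// addye.
Qed.

(** The hypothesis is stated with the exact Lipschitz constant of f. The bound only
    gets weaker when that constant is replaced by the upper bound l; f must not be
    constant, as the quotient by a vanishing Lipschitz constant is 0. *)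
Lemma lipschitz_stat_tail (K e m t : R) (x y : R) : (0 < n)%N ->
  0 <= K -> 0 <= e -> f x != f y -> 0 < t ->
  (forall (g : R -> R) (delta : R),
      (lip_norm g < +oo)%E -> 0 < delta ->
      (P [set w |
          delta%:E < `| (n%:R^-1 * \tr (fun_mx g (H w)))%:E -
                        (n%:R^-1)%:E *
                          'E_P[fun w' => \tr (fun_mx g (H w'))] |]
       <= (expR (- K *
             Num.min ((n%:R * delta / fine (lip_norm g)) ^+ 2)
                     ((n%:R * delta / fine (lip_norm g)) `^ (1 + e))))%:E)%E) ->
  (\int[P]_w (S w)%:E)%E = m%:E ->
  (P [set w | (t < `|\tr (fun_mx f (H w)) - n%:R * m|)%R ] <=
    (expR (- (K * Num.min ((t / l) ^+ 2) ((t / l) `^ (1 + e)))))%:E)%E.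
Proof.
move=> n0 K0 e0 fxy t0 HL Sm.
have nR0 : (0 < n%:R :> R) by rewrite ltr0n.
have mf : measurable_fun [set: R] f by exact: lipschitz_measurable f_lip.
have lE := lip_norm_le f_lip; have l_pos := lip_norm_gt0 fxy.
have lfin : lip_norm f \is a fin_num.
  by rewrite ge0_fin_numE ?ltW// (le_lt_trans lE)// ltry.
have {}HL := HL f (n%:R^-1 * t) (le_lt_trans lE (ltry _)).
have {HL} := HL (mulr_gt0 _ t0); rewrite invr_gt0 => /(_ nR0).
move: lE l_pos; rewrite -(fineK lfin) lee_fin lte_fin /=.
set q := fine _ => ql q0 HL.
have ET : ('E_P[fun w => \tr (fun_mx f (H w))] = (n%:R * m)%:E)%E.
  rewrite unlock EFinM -Sm -ge0_integralZl_EFin//; last 2 first.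
  - by move=> w _; rewrite lee_fin mulr_ge0 ?invr_ge0// trace_fun_mx_ge0.
  - by apply/measurable_EFinP; exact: measurable_lipschitz_stat.
  apply: eq_integral => w _; rewrite -EFinM mulrA mulfV ?mul1r//.
  by rewrite gt_eqF.
move: HL; rewrite ET mulrA mulfV ?gt_eqF// mul1r => HL.
apply: le_trans (le_trans _ HL) _.
  rewrite le_eqVlt; apply/orP; left; apply/eqP; congr (P _).
  apply/seteqP; split=> w /=; rewrite lte_fin -mulrBr normrM.
    by rewrite gtr0_norm ?invr_gt0// ltr_pM2l ?invr_gt0.
  by rewrite gtr0_norm ?invr_gt0// ltr_pM2l ?invr_gt0.
rewrite lee_fin ler_expR mulNr lerN2 ler_wpM2l//.
have tlq : t / l <= t / q by rewrite ler_pM2l// lef_pV2.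
have tl0 : 0 <= t / l by rewrite divr_ge0// ltW.
rewrite le_min !ge_min; apply/andP; split; apply/orP; [left|right].
  by rewrite lerXn2r// nnegrE (le_trans tl0).
have e1 : 0 <= 1 + e by lra.
by rewrite ge0_ler_powR ?nnegrE// (le_trans tl0).
Qed.

End LinearStatistics.

(** * Dyadic estimates near the origin *)

Lemma nneseries_geometric_le (R : realType) (A q : R) : 0 <= A -> 0 <= q < 1 ->
  (\sum_(0 <= k <oo) (A * q ^+ k)%:E <= (A / (1 - q))%:E)%E.
Proof.
move=> A0 /andP[q0 q1]; apply: lime_le.
  by apply: is_cvg_nneseries => k _ _; rewrite lee_fin mulr_ge0// exprn_ge0.
near=> n; rewrite sumEFin lee_fin.
have /(congr1 (@^~ n)) := geometric_seriesE A (negbT (lt_eqF q1)).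
rewrite /series/geometric/= => ->.
by rewrite ler_pM2r ?invr_gt0 ?subr_gt0// ler_piMr// gerBl exprn_ge0.
Unshelve. all: by end_near. Qed.

Lemma dyadic_shell (R : realType) (r x : R) : 0 < r -> x != 0 -> `|x| < r ->
  exists k, r / 2 ^+ k.+1 <= `|x| < r / 2 ^+ k.
Proof.
move=> r0 x0 xr; have nx0 : 0 < `|x| by rewrite normr_gt0.
have ex : exists k, r / 2 ^+ k.+1 <= `|x|.
  exists (Num.truncn (r / `|x|)); rewrite ler_pdivrMr ?exprn_gt0//.
  rewrite -ler_pdivrMl// mulrC (le_trans (ltW (truncnS_gt _)))//.
  by rewrite -natrX ler_nat ltnW// ltn_expl.
exists (ex_minn ex); case: ex_minnP => -[|k] -> kmin; first by rewrite divr1.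
rewrite ltNge; apply/negP => /kmin; by rewrite ltnn.
Qed.

Lemma dyadic_powR (R : realType) (r p : R) k : 0 <= r ->
  (r / 2 ^+ k) `^ p = r `^ p * (2 `^ (- p)) ^+ k.
Proof.
move=> r0; rewrite powRM// ?invr_ge0 ?exprn_ge0//; congr (_ * _).
rewrite -powR_invn// -powRrM -(powR_mulrn k (powR_ge0 _ _)) -powRrM.
by rewrite mulNr mulrC mulNr.
Qed.

Definition sym_itv (R : realType) (s : R) : set (measurableTypeR R) :=
  `]- s, s[%classic.

Lemma in_sym_itv (R : realType) (s x : R) : (x \in sym_itv s) = (`|x| < s).
Proof. by rewrite mem_setE in_itv/= ltr_norml. Qed.

Lemma sym_itvP (R : realType) (s x : R) : sym_itv s x <-> `|x| < s.
Proof. by rewrite -in_sym_itv; split=> [/mem_set|/set_mem]. Qed.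

Lemma measurable_sym_itv (R : realType) (s : R) : measurable (sym_itv s).
Proof. exact: measurable_itv. Qed.
Hint Resolve measurable_sym_itv : core.

(** The function phi is bounded on the k-th shell by the sum of c 0, ..., c k, hence
    everywhere by the series of the c k times the indicators of the intervals of
    radius r / 2^k, which is integrated term by term. The common lower bound c0 of
    the c k makes this series infinite at the origin, so that phi needs no bound
    there. *)
Section Dyadic.
Variables (R : realType) (mu : {measure set (measurableTypeR R) -> \bar R}).
Variables (r c0 A q : R) (c : nat -> R) (phi : R -> \bar R).
Hypothesis r_gt0 : 0 < r.
Hypothesis A_ge0 : 0 <= A.
Hypothesis q01 : 0 <= q < 1.
Hypothesis c0_gt0 : 0 < c0.
Hypothesis c_ge : forall k, c0 <= c k.
Hypothesis phi_ge0 : forall x, `|x| < r -> (0 <= phi x)%E.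
Hypothesis mphi :
  measurable_fun (sym_itv r) phi.
Hypothesis phi_le : forall k x, r / 2 ^+ k.+1 <= `|x| < r / 2 ^+ k ->
  (phi x <= (\sum_(0 <= j < k.+1) c j)%:E)%E.
Hypothesis mu_le : forall k,
  ((c k)%:E * mu (sym_itv (r / 2 ^+ k)) <= (A * q ^+ k)%:E)%E.

Local Notation B k := (sym_itv (r / 2 ^+ k)).

Let c_ge0 k : 0 <= c k.
Proof. exact: le_trans (ltW c0_gt0) (c_ge k). Qed.

Let rS k j : (j <= k)%N -> r / 2 ^+ k <= r / 2 ^+ j.
Proof.
move=> jk; rewrite ler_pM2l// lef_pV2 ?posrE ?exprn_gt0//.
by rewrite ler_weXn2l// ler1n.
Qed.

Let phi_le_series x : `|x| < r ->
  (phi x <= \sum_(0 <= k <oo) (c k * \1_(B k) x)%:E)%E.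
Proof.
move=> xr; have ge0 k : (0 <= (c k * \1_(B k) x)%:E)%E.
  by rewrite lee_fin mulr_ge0// indicE.
have ser k : ((\sum_(0 <= j < k) c j * \1_(B j) x)%:E <=
    \sum_(0 <= k <oo) (c k * \1_(B k) x)%:E)%E.
  by rewrite -sumEFin; apply: nneseries_lim_ge.
have [x0|x0] := eqVneq x 0; last first.
  have [k /andP[kx xk]] := dyadic_shell r_gt0 x0 xr.
  have := @phi_le k x; rewrite kx xk => /(_ isT) pk.
  apply: le_trans (le_trans pk _) (ser k.+1).
  rewrite lee_fin le_eqVlt; apply/orP; left; apply/eqP.
  rewrite !big_mkord; apply: eq_bigr => j _; rewrite indicE in_sym_itv.
  by rewrite (lt_le_trans xk) ?mulr1// rS// -ltnS.
suff -> : (\sum_(0 <= k <oo) (c k * \1_(B k) x)%:E = +oo)%E by rewrite leey.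
apply/eqyP => M M0; have := ser (Num.truncn (M / c0)).+1; apply: le_trans.
rewrite lee_fin (@le_trans _ _ (\sum_(0 <= j < (Num.truncn (M / c0)).+1) c0))//.
  rewrite sumr_const_nat subn0 -mulr_natr -ler_pdivrMl// mulrC.
  by rewrite ltW// truncnS_gt.
rewrite ler_sum// => j _; rewrite indicE in_sym_itv x0 normr0.
by rewrite divr_gt0 ?exprn_gt0// mulr1.
Qed.

Lemma dyadic_integral_le :
  (\int[mu]_(x in sym_itv r) phi x <= (A / (1 - q))%:E)%E.
Proof.
apply: le_trans (nneseries_geometric_le A_ge0 q01).
apply: (@le_trans _ _ (\int[mu]_(x in sym_itv r)
   \sum_(0 <= k <oo) (c k * \1_(B k) x)%:E)%E).
  apply: ge0_le_integral => //.
  - by move=> x /sym_itvP; exact: phi_ge0.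
  - apply: ge0_emeasurable_sum => k.
    + by move=> x _ _; rewrite lee_fin mulr_ge0// indicE.
    + by move=> _; apply/measurable_EFinP; apply: measurable_funM.
  - by move=> x /sym_itvP; exact: phi_le_series.
rewrite integral_nneseries//; last 2 first.
- by move=> k; apply/measurable_EFinP; apply: measurable_funM.
- by move=> k x _; rewrite lee_fin mulr_ge0// indicE.
apply: lee_nneseries => k.
  by move=> _ _; apply: integral_ge0 => x _; rewrite lee_fin mulr_ge0// indicE.
move=> _; apply: le_trans (mu_le k).
under eq_integral do rewrite EFinM.
rewrite ge0_integralZl_EFin//; last exact/measurable_EFinP.
apply: lee_wpmul2l; rewrite ?lee_fin// integral_indic//.
by rewrite le_measure ?inE//; exact: measurableI.
Qed.

End Dyadic.

Lemma powR2N_itv (R : realType) (p : R) : 0 < p -> 0 <= (2 : R) `^ (- p) < 1.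
Proof.
move=> p0; rewrite powR_ge0/= /powR pnatr_eq0/= expR_lt1 mulNr oppr_lt0.
by rewrite mulr_gt0// ln_gt0// ltr1n.
Qed.

(** On the k-th shell the density is at most c k = kappa^-1 (r / 2^(k+1))^(p-1),
    while the interval of radius r / 2^k has length 2 r / 2^k, so the products
    decay geometrically with ratio 2^(-p). The conditions p <= 1 and r <= 1 make
    the c k bounded below. *)
Lemma density_ball (R : realType) (kappa p r : R)
  (mu : probability (measurableTypeR R) R) (g : R -> R) :
  0 < kappa -> 0 < p -> p <= kappa -> p <= 1 ->
  0 < r -> r <= kappa -> r <= 1 ->
  measurable_fun `]- kappa, kappa[ g ->
  (forall x, `|x| < kappa -> 0 <= g x) ->
  (forall A : set (measurableTypeR R), measurable A ->
     A `<=` `]- kappa, kappa[ ->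
     mu A = (\int[lebesgue_measure]_(x in A) (g x)%:E)%E) ->
  (forall x, 0 < `|x| -> `|x| < kappa -> g x < kappa^-1 * `|x| `^ (-1 + kappa)) ->
  (mu (sym_itv r) <=
    (4 * kappa^-1 * 2 `^ (- p) / (1 - 2 `^ (- p)) * r `^ p)%:E)%E.
Proof.
move=> k0 p0 pk p1 r0 rk r1 mg g0 muE gk.
have sub : sym_itv r `<=` `]- kappa, kappa[%classic.
  by move=> x /sym_itvP xr; apply/sym_itvP; exact: lt_le_trans rk.
rewrite (muE _ (measurable_sym_itv r) sub).
have rk0 k : 0 < r / 2 ^+ k by rewrite divr_gt0// exprn_gt0.
have rk1 k : r / 2 ^+ k <= 1.
  by rewrite ler_pdivrMr ?exprn_gt0// mul1r (le_trans r1)// exprn_ege1// ler1n.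
have leb k : (lebesgue_measure (sym_itv (r / 2 ^+ k)) =
    (r / 2 ^+ k - - (r / 2 ^+ k))%:E)%E.
  rewrite /sym_itv lebesgue_measure_itv/= lte_fin ifT//.
  by have := rk0 k; lra.
rewrite mulrAC; apply: (@dyadic_integral_le R lebesgue_measure r kappa^-1
  (4 * kappa^-1 * 2 `^ (- p) * r `^ p) (2 `^ (- p))
  (fun k => kappa^-1 * (r / 2 ^+ k.+1) `^ (p - 1)) (EFin \o g)) => //.
- by rewrite !mulr_ge0 ?powR_ge0// invr_ge0 ltW.
- exact: powR2N_itv.
- by rewrite invr_gt0.
- move=> k; rewrite ler_pMr ?invr_gt0// -[leLHS](powRr0 (r / 2 ^+ k.+1)).
  by rewrite ger_powR ?rk0 ?rk1// subr_le0.
- by move=> x xr; rewrite lee_fin g0// (lt_le_trans xr).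
- apply/measurable_EFinP; apply: measurable_funS mg => //.
- move=> k x /andP[xk kx]; rewrite lee_fin.
  have x0 : 0 < `|x| by exact: lt_le_trans xk.
  have xr : `|x| < r.
    apply: (lt_le_trans kx); rewrite ler_pdivrMr ?exprn_gt0//.
    by rewrite ler_pMr// exprn_ege1// ler1n.
  rewrite big_nat_recr//= (@le_trans _ _ (kappa^-1 * (r / 2 ^+ k.+1) `^ (p - 1)))//.
    apply: (le_trans (ltW (gk _ x0 (lt_le_trans xr rk)))).
    rewrite ler_pM2l ?invr_gt0// (@le_trans _ _ (`|x| `^ (p - 1)))//.
      rewrite ger_powR ?x0 ?(le_trans (ltW xr))//; lra.
    have -> : p - 1 = - (1 - p) by lra.
    by rewrite !powRN lef_pV2 ?posrE ?powR_gt0// ge0_ler_powR ?nnegrE ?subr_ge0// ltW.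
  rewrite lerDr sumr_ge0// => j _; rewrite mulr_ge0 ?powR_ge0// invr_ge0 ltW//.
- move=> k.
  rewrite [X in (_ * X)%E](_ : _ = (r / 2 ^+ k - - (r / 2 ^+ k))%:E); last exact: leb.
  rewrite -EFinM lee_fin.
  have E : (r / 2 ^+ k.+1) `^ (p - 1) * (r / 2 ^+ k.+1) = (r / 2 ^+ k.+1) `^ p.
    by rewrite mulrC mulr_powRB1// ltW.
  have E2 : r / 2 ^+ k = 2 * (r / 2 ^+ k.+1).
    rewrite exprS; field.
    by rewrite expf_neq0.
  have -> : kappa^-1 * (r / 2 ^+ k.+1) `^ (p - 1) * (r / 2 ^+ k - - (r / 2 ^+ k)) =
      4 * kappa^-1 * ((r / 2 ^+ k.+1) `^ (p - 1) * (r / 2 ^+ k.+1)).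
    rewrite E2; ring.
  rewrite E (dyadic_powR _ _ (ltW r0)) exprS le_eqVlt; apply/orP; left; apply/eqP; ring.
Qed.

Lemma measurable_lne_norm (R : realType) :
  measurable_fun [set: measurableTypeR R] (fun x : R => lne `|x|%:E).
Proof.
rewrite /lne; apply: measurable_fun_ifT => //=.
  by apply: measurable_fun_ler => //; exact: normr_measurable.
apply/measurable_EFinP; apply: measurableT_comp; first exact: measurable_ln.
exact: normr_measurable.
Qed.

(** On the k-th shell log (r / |x|) <= (k + 1) log 2, which is a sum of k + 1 equal
    terms c j = log 2. *)
Lemma log_deficit (R : realType) (C p r : R)
  (mu : probability (measurableTypeR R) R) :
  0 < p -> 0 < r -> 0 <= C ->
  (forall s, 0 < s -> s <= r -> (mu (sym_itv s) <= (C * s `^ p)%:E)%E) ->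
  (\int[mu]_(x in sym_itv r) ((ln r)%:E - lne `|x|%:E) <=
    (ln 2 * C / (1 - 2 `^ (- p)) * r `^ p)%:E)%E.
Proof.
move=> p0 r0 C0 muC.
have ln2 : 0 < ln 2 :> R by rewrite ln_gt0// ltr1n.
rewrite mulrAC; apply: (@dyadic_integral_le R mu r (ln 2) (ln 2 * C * r `^ p)
  (2 `^ (- p)) (fun=> ln 2) (fun x => (ln r)%:E - lne `|x|%:E)%E) => //.
- by rewrite !mulr_ge0 ?powR_ge0// ltW.
- exact: powR2N_itv.
- move=> x xr; have [->|x0] := eqVneq x 0.
    by rewrite normr0 le0_lneNy//= addey// leey.
  by rewrite lne_EFin ?normr_gt0// lee_fin subr_ge0 ler_ln// ?posrE ?normr_gt0// ltW.
- apply: emeasurable_funB => //.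
  by apply: measurable_funTS; exact: measurable_lne_norm.
- move=> k x /andP[xk kx].
  have rk0 : 0 < r / 2 ^+ k.+1 by rewrite divr_gt0// exprn_gt0.
  rewrite lne_EFin ?(lt_le_trans rk0)// lee_fin sumr_const_nat subn0.
  have : ln (r / 2 ^+ k.+1) <= ln `|x| by rewrite ler_ln ?posrE// (lt_le_trans rk0).
  rewrite ln_div ?posrE ?exprn_gt0// lnXn//.
  set u := _ *+ _; lra.
- move=> k; have rk0 : 0 < r / 2 ^+ k by rewrite divr_gt0// exprn_gt0.
  have rk : r / 2 ^+ k <= r.
    by rewrite ler_pdivrMr ?exprn_gt0// ler_pMr// exprn_ege1// ler1n.
  apply: (@le_trans _ _ ((ln 2)%:E * (C * (r / 2 ^+ k) `^ p)%:E)%E).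
    by apply: lee_wpmul2l; [rewrite lee_fin ltW|exact: muC].
  by rewrite -EFinM lee_fin (dyadic_powR _ _ (ltW r0)) !mulrA.
Qed.

(** * The truncated logarithm and the tent *)

(** Shifting the truncated logarithm by log eta makes it nonnegative. *)
Definition log_plus (R : realType) (eta x : R) : R := ln (Num.max (`|x| / eta) 1).

(** A Lipschitz majorant of the indicator of [-eta, eta], supported in
    [-2 eta, 2 eta]. *)
Definition tent (R : realType) (eta x : R) : R := Num.max 0 (2 - `|x| / eta).

Section TestFunctions.
Variables (R : realType) (eta : R).
Hypothesis eta0 : 0 < eta.

Let dist_quot (x y : R) : `|x| / eta - `|y| / eta <= eta^-1 * `|x - y|.
Proof.
by rewrite -mulrBl mulrC ler_pM2l ?invr_gt0// lerB_dist.
Qed.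

Lemma log_plus_ge0 (x : R) : 0 <= log_plus eta x.
Proof. by rewrite ln_ge0// le_max lexx orbT. Qed.

Lemma log_plus_small (x : R) : `|x| <= eta -> log_plus eta x = 0.
Proof.
by move=> xe; rewrite /log_plus max_r ?ln1// ler_pdivrMr// mul1r.
Qed.

Lemma log_plus_large (x : R) : eta <= `|x| -> log_plus eta x = ln `|x| - ln eta.
Proof.
move=> ex; rewrite /log_plus max_l ?ler_pdivlMr ?mul1r// ln_div// posrE//.
exact: lt_le_trans ex.
Qed.

Lemma log_plus_lip (x y : R) :
  `|log_plus eta x - log_plus eta y| <= eta^-1 * `|x - y|.
Proof.
suff W u v : log_plus eta u - log_plus eta v <= eta^-1 * `|u - v|.
  by rewrite ler_norml W andbT lerNl opprB distrC W.
rewrite /log_plus; set a := Num.max (_ / _) _; set b := Num.max _ _.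
have b1 : 1 <= b by rewrite le_max lexx orbT.
have a1 : 1 <= a by rewrite le_max lexx orbT.
have a0 : 0 < a by exact: lt_le_trans a1.
have b0 : 0 < b by exact: lt_le_trans b1.
have nn : 0 <= eta^-1 * `|u - v| by rewrite mulr_ge0// invr_ge0 ltW.
have [ab|ba] := leP a b.
  by apply: (le_trans _ nn); rewrite subr_le0 ler_ln.
rewrite -ln_div// (_ : a / b = 1 + (a - b) / b); last first.
  by rewrite mulrBl mulfV ?gt_eqF//; lra.
have ab0 : 0 <= (a - b) / b by rewrite divr_ge0 ?subr_ge0// ltW.
rewrite (le_trans (le_ln1Dx _))//; first by lra.
rewrite (@le_trans _ _ (a - b))//.
  by rewrite ler_pdivrMr// ler_peMr// subr_ge0 ltW.
have pq := dist_quot u v.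
have bq : `|v| / eta <= b by rewrite le_max lexx.
by rewrite lerBlDr /a ge_max; apply/andP; split; lra.
Qed.

Lemma tent_ge0 (x : R) : 0 <= tent eta x.
Proof. by rewrite le_max lexx. Qed.

Lemma tent_ge1 (x : R) : `|x| <= eta -> 1 <= tent eta x.
Proof.
move=> xe; rewrite le_max; apply/orP; right.
have : `|x| / eta <= 1 by rewrite ler_pdivrMr// mul1r.
by lra.
Qed.

Lemma tent_le_indic (x : R) : tent eta x <= 2 * \1_(sym_itv (2 * eta)) x.
Proof.
rewrite indicE in_sym_itv; case: ltP => [_|xe].
  rewrite mulr1 ge_max ler0n/=.
  have : 0 <= `|x| / eta by rewrite divr_ge0// ltW.
  by lra.
rewrite mulr0 ge_max lexx/=; have : 2 <= `|x| / eta by rewrite ler_pdivlMr.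
by lra.
Qed.

Lemma tent_lip (x y : R) : `|tent eta x - tent eta y| <= eta^-1 * `|x - y|.
Proof.
suff W u v : tent eta u - tent eta v <= eta^-1 * `|u - v|.
  by rewrite ler_norml W andbT lerNl opprB distrC W.
have nn : 0 <= eta^-1 * `|u - v| by rewrite mulr_ge0// invr_ge0 ltW.
rewrite lerBlDr ge_max; apply/andP; split.
  by rewrite addr_ge0// tent_ge0.
rewrite -lerBlDl (le_trans _ (_ : 2 - `|v| / eta <= _))//; last first.
  by rewrite /tent le_max lexx orbT.
by have := dist_quot v u; rewrite distrC; lra.
Qed.

End TestFunctions.

Section DeterminantBounds.
Variables (R : realType) (n : nat) (A : 'M[R]_n) (eta : R).
Hypothesis symA : A^T = A.
Hypothesis eta0 : 0 < eta.

Let detE : `|\det A| = \prod_(x <- eigenvalues A) `|x|.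
Proof. by rewrite det_eigenvalues// normr_prod. Qed.

Let sum_cst (c : R) : \sum_(x <- eigenvalues A) c = n%:R * c.
Proof.
by rewrite big_const_seq count_predT size_eigenvalues// iter_addr_0 mulr_natl.
Qed.

Lemma normr_det_le :
  `|\det A| <= expR (\tr (fun_mx (log_plus eta) A) + n%:R * ln eta).
Proof.
rewrite detE trace_fun_mx// -sum_cst -big_split/= expR_sum.
apply: ler_prod => x _; rewrite normr_ge0/=.
have [xe|ex] := leP `|x| eta.
  by rewrite log_plus_small// add0r lnK.
by rewrite (log_plus_large eta0 (ltW ex)) subrK lnK// posrE (lt_trans eta0).
Qed.

(** An eigenvalue outside [-eta, eta] contributes log |lambda| to log |det A| and at
    most that to the exponent, the tent being nonnegative. One
    inside contributes at least - M to log |det A| because of the gap, and at most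
    - M to the exponent, since the tent is at least 1 there and log eta <= 0. *)
Lemma normr_det_ge (M : R) : 0 <= M -> eta <= 1 ->
  (forall x, - expR (- M) <= x <= expR (- M) -> ~~ eigenvalue A x) ->
  expR (\tr (fun_mx (log_plus eta) A) + n%:R * ln eta -
        M * \tr (fun_mx (tent eta) A)) <= `|\det A|.
Proof.
move=> M0 eta1 gap.
rewrite detE !trace_fun_mx// -sum_cst mulr_sumr -big_split/= -sumrB expR_sum.
rewrite big_seq [leRHS]big_seq.
apply: ler_prod => x; rewrite mem_eigenvalues => Ax; rewrite expR_ge0/=.
have Mx : expR (- M) < `|x|.
  rewrite ltNge ler_norml; apply/negP => /gap; by rewrite Ax.
have x0 : 0 < `|x| by exact: lt_trans (expR_gt0 _) Mx.
rewrite -[leRHS]lnK ?posrE// ler_expR.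
have t0 := tent_ge0 eta x.
have [xe|ex] := leP `|x| eta.
  rewrite log_plus_small// add0r.
  have l0 : ln eta <= 0 by rewrite ln_le0.
  have : - M <= ln `|x| by rewrite -[- M]expRK ler_ln ?posrE ?expR_gt0// ltW.
  by have := ler_wpM2l M0 (tent_ge1 eta0 xe); lra.
by rewrite (log_plus_large eta0 (ltW ex)) subrK lerBlDr lerDl mulr_ge0.
Qed.

End DeterminantBounds.

(** * Logarithmic integral and exponential moment *)

Lemma lipschitz_integral_lty (R : realType)
  (mu : probability (measurableTypeR R) R) (K : set R) (f : R -> R) (l : R) :
  compact K -> mu (~` K) = 0%E -> (forall x, 0 <= f x) ->
  (forall x y, `|f x - f y| <= l * `|x - y|) ->
  (\int[mu]_x (f x)%:E < +oo)%E.
Proof.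
move=> cK muK f0 fl; have [M [_ MK]] := compact_bounded cK.
have {}MK x : K x -> `|x| <= M + 1 by apply: MK; rewrite ltrDl.
have l0 : 0 <= l.
  by have := fl 1 0; rewrite subr0 normr1 mulr1; apply: le_trans.
set C := `|f 0 + l * (M + 1)|.
apply: (@le_lt_trans _ _ (\int[mu]_x (cst C%:E x))%E); last first.
  by rewrite integral_cst//= probability_setT mule1 ltry.
apply: ae_ge0_le_integral => //.
- by move=> x _; rewrite lee_fin.
- by apply/measurable_EFinP; exact: lipschitz_measurable fl.
- by move=> x _; rewrite lee_fin /C.
exists (~` K); split => //.
  by apply: measurableC; exact: compact_measurable.
move=> x /= nx Kx; apply: nx => _; rewrite lee_fin (le_trans _ (ler_norm _))//.
have := fl x 0; rewrite subr0 => /(le_trans (ler_norm _)).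
by have := ler_wpM2l l0 (MK x Kx); lra.
Qed.

(** The function log |x| is log_plus eta x + log eta minus the deficit
    log (eta / |x|) on (-eta, eta), whose integral is small. Working with the
    nonnegative deficit in the extended reals also shows that log |x| is
    integrable, the value -oo at the origin included. *)
Lemma integral_lne_norm (R : realType)
  (mu : probability (measurableTypeR R) R) (C p eta : R) :
  0 < p -> 0 < eta -> 0 <= C ->
  (forall s, 0 < s -> s <= eta -> (mu (sym_itv s) <= (C * s `^ p)%:E)%E) ->
  (\int[mu]_x (log_plus eta x)%:E < +oo)%E ->
  exists j a : R, [/\ (\int[mu]_x lne `|x|%:E)%E = j%:E,
    (\int[mu]_x (log_plus eta x)%:E)%E = a%:E &
    0 <= a + ln eta - j <= ln 2 * C / (1 - 2 `^ (- p)) * eta `^ p].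
Proof.
move=> p0 eta0 C0 muC Foo.
have mF : measurable_fun [set: measurableTypeR R] (EFin \o log_plus eta).
  apply/measurable_EFinP; exact: lipschitz_measurable (log_plus_lip eta0).
have F0 x : (0 <= (log_plus eta x)%:E)%E by rewrite lee_fin log_plus_ge0.
have iF : mu.-integrable [set: measurableTypeR R] (EFin \o log_plus eta).
  apply/integrableP; split; first exact: mF.
  rewrite (eq_integral (EFin \o log_plus eta : measurableTypeR R -> \bar R))// => x _.
  by rewrite gee0_abs// F0.
have ic := finite_measure_integrable_cst mu (ln eta) (@measurableT _ (measurableTypeR R)).
pose h : measurableTypeR R -> \bar R :=
  (fun x => (ln eta)%:E - lne `|x|%:E)%E \_ (sym_itv eta).
have h0 x : (0 <= h x)%E.
  apply: erestrict_ge0 => y /sym_itvP ye.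
  have [->|y0] := eqVneq y 0; first by rewrite normr0 le0_lneNy//= addey// leey.
  by rewrite lne_EFin ?normr_gt0// lee_fin subr_ge0 ler_ln// ?posrE ?normr_gt0// ltW.
have hle : (\int[mu]_x h x <= (ln 2 * C / (1 - 2 `^ (- p)) * eta `^ p)%:E)%E.
  by rewrite /h -integral_mkcond; apply: log_deficit.
have mh : measurable_fun [set: measurableTypeR R] h.
  apply/(measurable_restrictT _ (measurable_sym_itv eta)).
  by apply: emeasurable_funB => //; apply: measurable_funTS; exact: measurable_lne_norm.
have ih : mu.-integrable [set: measurableTypeR R] h.
  apply/integrableP; split=> //; rewrite (eq_integral h)//.
    by rewrite (le_lt_trans hle)// ltry.
  by move=> x _; rewrite gee0_abs// h0.
have E : (\int[mu]_x lne `|x|%:E)%E =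
    ((\int[mu]_x (log_plus eta x)%:E + (ln eta)%:E) - \int[mu]_x h x)%E.
  transitivity (\int[mu]_x (((EFin \o log_plus eta) \+ (EFin \o cst (ln eta))) \- h) x)%E.
    apply: eq_integral => x _; rewrite /h /patch in_sym_itv.
    rewrite (_ : ((EFin \o _) \+ _)%E x = (log_plus eta x + ln eta)%:E)//.
    have [xe|ex] := ltP `|x| eta.
      rewrite (log_plus_small eta0 (ltW xe)) add0r.
      case: (lne `|x|%:E) => [s| |]//=.
      by congr EFin; lra.
    rewrite log_plus_large// subrK lne_EFin ?(lt_le_trans eta0)//.
    by rewrite /point/= sube0.
  rewrite integralB//; last exact: integrableD.
  rewrite integralD//; congr (_ + _ - _)%E.
  transitivity (\int[mu]_x (cst (ln eta)%:E x))%E => //.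
  by rewrite integral_cst//= probability_setT mule1.
have : (0 <= \int[mu]_x h x)%E by exact: integral_ge0.
have := integrable_fin_num measurableT iF; have := integrable_fin_num measurableT ih.
move: E hle; case: (\int[mu]_x h x)%E => // b; rewrite /comp.
case: (\int[mu]_x (log_plus eta x)%:E)%E => // a -> hle _ _ b0.
exists (a + ln eta - b), a; split => //.
by move: hle b0; rewrite !lee_fin => hle b0; apply/andP; split; lra.
Qed.

(** If m + k < X <= m + k + 1 then exp X <= exp (m + k + 1), an event of
    probability at most exp (- 2 (m + k)); the sum over k is geometric with ratio
    exp (-1). *)
Lemma exponential_moment_le (R : realType) (d : measure_display)
  (T : measurableType d) (P : probability T R) (X : T -> R) (m : nat) :
  measurable_fun [set: T] X ->
  (forall k, (m <= k)%N ->
    (P [set w | (k%:R < X w)%R] <= (expR (- (2 * k%:R)))%:E)%E) ->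
  (\int[P]_w (expR (X w))%:E <= (expR (m%:R) + expR 1 / (1 - expR (- 1)))%:E)%E.
Proof.
move=> mX PX.
pose B k := [set w | (m + k)%:R < X w].
have mB k : measurable (B k).
  by rewrite -[B k]setTI; exact: measurable_fun_ltr.
have e1 : 0 <= expR (- 1 : R) < 1 by rewrite expR_ge0/= expR_lt1 oppr_lt0 ltr01.
have ge0 k w : (0 <= (expR (m + k).+1%:R * \1_(B k) w)%:E)%E.
  by rewrite lee_fin mulr_ge0 ?expR_ge0// indicE.
have mI k : measurable_fun [set: T] (fun w => (expR (m + k).+1%:R * \1_(B k) w)%:E).
  apply/measurable_EFinP; apply: measurable_funM => //.
apply: (@le_trans _ _ (\int[P]_w ((expR m%:R)%:E +
    \sum_(0 <= k <oo) (expR (m + k).+1%:R * \1_(B k) w)%:E))%E).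
  apply: ge0_le_integral => //.
  - by apply/measurable_EFinP; apply: measurableT_comp.
  - by apply: emeasurable_funD => //; exact: ge0_emeasurable_sum.
  move=> w _; have [Xm|mX'] := leP (X w) m%:R.
    by rewrite -[leLHS]adde0 leeD// ?lee_fin ?ler_expR//; exact: nneseries_ge0.
  apply: (@le_trans _ _ (\sum_(0 <= k <oo) (expR (m + k).+1%:R * \1_(B k) w)%:E)%E);
    last by rewrite leeDr// lee_fin expR_ge0.
  have ex : exists k, X w <= (m + k).+1%:R.
    exists (Num.truncn (X w)); rewrite ltW// (lt_le_trans (truncnS_gt _))//.
    by rewrite ler_nat ltnS leq_addl.
  case: (ex_minnP ex) => k Xk kmin.
  have Bk : B k w.
    rewrite /B/=; case: k kmin {Xk} => [|k] kmin; first by rewrite addn0.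
    by rewrite ltNge addnS; apply/negP => /kmin; rewrite ltnn.
  apply: (@le_trans _ _ (\sum_(0 <= i < k.+1) (expR (m + i).+1%:R * \1_(B i) w)%:E)%E);
    last exact: nneseries_lim_ge.
  rewrite big_nat_recr//= -[leLHS]add0e leeD//; first exact: sume_ge0.
  by rewrite lee_fin indicE mem_set// mulr1 ler_expR.
rewrite ge0_integralD//; last 2 first.
- by move=> w _; exact: nneseries_ge0.
- exact: ge0_emeasurable_sum.
rewrite EFinD leeD//.
  by rewrite (_ : (fun _ => _) = cst (expR m%:R)%:E)// integral_cst//=
    probability_setT mule1.
rewrite integral_nneseries//.
apply: le_trans (nneseries_geometric_le (expR_ge0 1) e1).
apply: lee_nneseries => k; first by move=> _ _; exact: integral_ge0.
move=> _; under eq_integral do rewrite EFinM.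
rewrite ge0_integralZl_EFin ?expR_ge0//; last exact/measurable_EFinP.
rewrite integral_indic// setIT.
apply: (@le_trans _ _ ((expR (m + k).+1%:R)%:E * (expR (- (2 * (m + k)%:R)))%:E)%E).
  apply: lee_wpmul2l; first by rewrite lee_fin expR_ge0.
  by apply: PX; rewrite leq_addr.
rewrite -EFinM lee_fin -expRM_natl -!expRD ler_expR -addn1 !natrD.
by have := ler0n R m; lra.
Qed.

(** * Expected determinant at a fixed size *)

Lemma measurable_det (R : realType) (d : measure_display) (T : measurableType d)
  (n : nat) (H : T -> 'M[R]_n) :
  (forall i j, measurable_fun [set: T] (fun w => H w i j)) ->
  measurable_fun [set: T] (fun w => \det (H w)).
Proof.
move=> mH; apply: measurable_sum => s; apply: measurable_funM => //.
by apply: measurable_prod => i _.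
Qed.

(** The gap event says that the spectral distribution, a measurable function of the
    sample, gives no mass to the interval. *)
Lemma measurable_gap (R : realType) (d : measure_display) (T : measurableType d)
  (n : nat) (H : T -> 'M[R]_n) (a : R) :
  (forall i j, measurable_fun [set: T] (fun w => H w i j)) ->
  (forall w, (H w)^T = H w) ->
  measurable [set w | forall x, - a <= x <= a -> ~~ eigenvalue (H w) x].
Proof.
move=> mH sH; have [n0|n0] := eqVneq n 0%N.
  rewrite (_ : [set _ | _] = setT); first exact: measurableT.
  apply/seteqP; split=> // w _ x _; rewrite -mem_eigenvalues.
  by rewrite (size0nil (s := eigenvalues _)) ?size_eigenvalues.
pose B : set (measurableTypeR R) := `[- a, a]%classic.
rewrite (_ : [set _ | _] = [set: T] `&` (fun w => esd (H w) B) @^-1` [set 0%E]).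
  by apply: measurable_esd => //; exact: measurable_itv.
have iB x : \1_B x = ((- a <= x <= a)%R)%:R :> R.
  by rewrite indicE mem_setE in_itv.
rewrite setTI; apply/seteqP; split=> w /=; rewrite esdE// trace_fun_mx//.
  move=> gap; rewrite big_seq big1 ?mulr0// => x.
  rewrite mem_eigenvalues iB; case: (boolP (_ <= _ <= _)) => // /gap xw.
  by rewrite (negbTE xw).
move=> /eqP; rewrite eqe mulf_eq0 invr_eq0 pnatr_eq0 (negbTE n0)/=.
rewrite psumr_eq0 => [/allP s0 x xa|x _]; last by rewrite iB.
apply/negP; rewrite -mem_eigenvalues => /s0.
by rewrite iB xa oner_eq0.
Qed.

(** The number m is the normalised mean of the truncated logarithm, and m0 the scale
    above which the fluctuations of its trace have exponential tails. *)
Section FixedSize.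
Variables (R : realType) (d : measure_display) (T : measurableType d).
Variables (P : probability T R) (n : nat) (H : T -> 'M[R]_n).
Hypothesis mH : forall i j, measurable_fun [set: T] (fun w => H w i j).
Hypothesis symH : forall w, (H w)^T = H w.
Hypothesis n0 : (0 < n)%N.
Variables (eta m : R) (m0 : nat).
Hypothesis eta0 : 0 < eta.
Hypothesis tail : forall t, m0%:R <= t ->
  (P [set w | (t < `|\tr (fun_mx (log_plus eta) (H w)) - n%:R * m|)%R ] <=
    (expR (- (2 * t)))%:E)%E.

Local Notation trF := (fun w => \tr (fun_mx (log_plus eta) (H w))).
Local Notation trG := (fun w => \tr (fun_mx (tent eta) (H w))).

Let mF : measurable_fun [set: T] trF.
Proof.
apply: measurable_trace_fun_mx => // [|x]; last exact: log_plus_ge0.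
exact: lipschitz_measurable (log_plus_lip eta0).
Qed.

Let mG : measurable_fun [set: T] trG.
Proof.
apply: measurable_trace_fun_mx => // [|x]; last exact: tent_ge0.
exact: lipschitz_measurable (tent_lip eta0).
Qed.

Let mdet : measurable_fun [set: T] (fun w => (`|\det (H w)|%:E)).
Proof.
apply/measurable_EFinP; apply: measurableT_comp; first exact: normr_measurable.
exact: measurable_det.
Qed.

Lemma expected_det_le :
  (\int[P]_w `|\det (H w)|%:E <=
   (expR (n%:R * (m + ln eta)) *
    (expR m0%:R + expR 1 / (1 - expR (- 1))))%:E)%E.
Proof.
have mX : measurable_fun [set: T] (fun w => trF w - n%:R * m).
  exact: measurable_funB.
apply: (@le_trans _ _ (\int[P]_w
    ((expR (n%:R * (m + ln eta)))%:E * (expR (trF w - n%:R * m))%:E))%E).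
  apply: ge0_le_integral => //.
    apply: measurable_funeM; apply/measurable_EFinP.
    by apply: measurableT_comp => //; exact: measurable_expR.
  move=> w _; rewrite -EFinM lee_fin -expRD (le_trans (normr_det_le (symH w) eta0))//.
  by rewrite ler_expR; lra.
rewrite ge0_integralZl_EFin ?expR_ge0//; last first.
  by apply/measurable_EFinP; apply: measurableT_comp.
rewrite EFinM; apply: lee_wpmul2l; first by rewrite lee_fin expR_ge0.
apply: exponential_moment_le => // k mk.
apply: le_trans (@tail k%:R _); last by rewrite ler_nat.
apply: le_measure; rewrite ?inE.
- by rewrite -[X in measurable X]setTI; exact: measurable_fun_ltr.
- rewrite -[X in measurable X]setTI; apply: measurable_fun_ltr => //.
  by apply: measurableT_comp => //; exact: normr_measurable.
- by move=> w /= /lt_le_trans; apply; exact: ler_norm.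
Qed.

Let markov_tent (g : R) : 0 < g ->
  (\int[P]_w (n%:R^-1 * trG w)%:E <= g%:E)%E ->
  (P [set w | (n%:R * (4 * g) < trG w)%R] <= 4^-1%:E)%E.
Proof.
move=> g0 Gg; set B := [set w | _].
have nR : 0 < n%:R :> R by rewrite ltr0n.
have mB : measurable B.
  by rewrite -[B]setTI; exact: measurable_fun_ltr.
have : ((4 * g)%:E * P B <= g%:E)%E.
  apply: le_trans Gg; rewrite -[B]setIT -integral_indic//.
  rewrite -ge0_integralZl_EFin//; last 2 first.
  - exact/measurable_EFinP.
  - by rewrite mulr_ge0// ltW.
  apply: ge0_le_integral => //.
  - by move=> w _; rewrite lee_fin mulr_ge0 ?indicE// mulr_ge0// ltW.
  - by apply/measurable_EFinP; apply: measurable_funM.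
  - by apply/measurable_EFinP; apply: measurable_funM.
  move=> w _; rewrite -EFinM lee_fin indicE.
  have G0 : 0 <= trG w by rewrite trace_fun_mx// sumr_ge0// => x _; exact: tent_ge0.
  have [/set_mem Bw|_] := boolP (w \in B); last first.
    by rewrite mulr0 mulr_ge0// invr_ge0.
  by rewrite mulr1 ler_pdivlMl// ltW.
rewrite -(fineK (fin_num_measure P _ mB)) -EFinM !lee_fin => le1.
by rewrite -(ler_pM2l g0) [leRHS]mulrC ler_pdivlMl// mulrA.
Qed.

(** The lower bound of |det H| holds on the intersection of three events: the gap,
    a fluctuation of the truncated statistic of at most m0, and a trace of the tent
    of at most four times its expected bound. The last two fail with probability at
    most 1/4 each, so the intersection has probability at least 1/4. *)
Lemma expected_det_ge (M g : R) : 0 <= M -> 0 < g -> eta <= 1 -> (0 < m0)%N ->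
  (\int[P]_w (n%:R^-1 * trG w)%:E <= g%:E)%E ->
  ((3 / 4)%:E <= P [set w | forall x,
     (- expR (- M) <= x <= expR (- M))%R -> ~~ eigenvalue (H w) x])%E ->
  ((expR (n%:R * (m + ln eta) - m0%:R - M * (n%:R * (4 * g))) / 4)%:E <=
   \int[P]_w `|\det (H w)|%:E)%E.
Proof.
move=> M0 g0 eta1 m00 Gg; set A := [set w | _] => PA.
have mA : measurable A by exact: measurable_gap.
set B := [set w | (n%:R * (4 * g) < trG w)%R].
set D := [set w | (m0%:R < `|trF w - n%:R * m|)%R].
have mB : measurable B.
  by rewrite -[B]setTI; exact: measurable_fun_ltr.
have mD : measurable D.
  rewrite -[D]setTI; apply: measurable_fun_ltr => //.
  by apply: measurableT_comp; [exact: normr_measurable|exact: measurable_funB].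
pose E := A `\` (B `|` D).
have mE : measurable E by apply: measurableD => //; exact: measurableU.
have PB : (P B <= 4^-1%:E)%E by exact: markov_tent.
have PD : (P D <= 4^-1%:E)%E.
  apply: (le_trans (@tail _ (lexx _))); rewrite lee_fin.
  rewrite expRN lef_pV2 ?posrE ?expR_gt0//.
  have := expR_ge1Dx (m0%:R : R); have : 1 <= m0%:R :> R by rewrite ler1n.
  rewrite expRM_natl expr2 => m1 e1.
  have -> : (4 : R) = 2 * 2 by lra.
  by apply: ler_pM => //; lra.
have PE : (4^-1%:E <= P E)%E.
  have : (P A <= P E + (P B + P D))%E.
    apply: (@le_trans _ _ (P (E `|` (B `|` D)))).
      apply: le_measure; rewrite ?inE//.
        by apply: measurableU => //; exact: measurableU.
      by move=> w Aw; have [?|?] := pselect ((B `|` D) w); [right|left].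
    apply: (le_trans (measureU2 _ _ _)) => //; first exact: measurableU.
    by rewrite leeD2l//; exact: measureU2.
  move: PA PB PD.
  rewrite -(fineK (fin_num_measure P _ mA)) -(fineK (fin_num_measure P _ mB)).
  rewrite -(fineK (fin_num_measure P _ mD)) -(fineK (fin_num_measure P _ mE)).
  rewrite -!EFinD !lee_fin; lra.
set v := expR _.
apply: (@le_trans _ _ (v%:E * P E)%E).
  by rewrite EFinM; apply: lee_wpmul2l; rewrite ?lee_fin ?expR_ge0.
rewrite -[E]setIT -integral_indic// -ge0_integralZl_EFin ?expR_ge0//; last first.
  exact/measurable_EFinP.
apply: ge0_le_integral => //.
- by move=> w _; rewrite lee_fin mulr_ge0 ?expR_ge0 ?indicE.
- by apply/measurable_EFinP; apply: measurable_funM.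
move=> w _; rewrite -EFinM lee_fin indicE.
have [/set_mem[Aw /not_orP[nB nD]]|_] := boolP (w \in E); last by rewrite mulr0.
rewrite mulr1 (le_trans _ (normr_det_ge (symH w) eta0 M0 eta1 Aw))//.
rewrite ler_expR.
have {}nB : trG w <= n%:R * (4 * g) by rewrite leNgt; apply/negP.
have : `|trF w - n%:R * m| <= m0%:R by rewrite leNgt; apply/negP.
rewrite ler_norml => /andP[nD1 _].
by have := ler_wpM2l M0 nB; lra.
Qed.

Lemma log_expected_det (M g : R) : 0 <= M -> 0 < g -> eta <= 1 -> (0 < m0)%N ->
  (\int[P]_w (n%:R^-1 * trG w)%:E <= g%:E)%E ->
  ((3 / 4)%:E <= P [set w | forall x,
     (- expR (- M) <= x <= expR (- M))%R -> ~~ eigenvalue (H w) x])%E ->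
  exists2 y : R,
    ((n%:R^-1)%:E * lne 'E_P[fun w => (`| \det (H w) |)%R])%E = y%:E &
    `|y - (m + ln eta)| <=
      (m0%:R + (ln 4 + ln (1 + expR 1 / (1 - expR (- 1))))) / n%:R + M * (4 * g).
Proof.
move=> M0 g0 eta1 m00 Gg PA.
have := expected_det_ge M0 g0 eta1 m00 Gg PA; have := expected_det_le.
rewrite unlock; case: (\int[P]_w _)%E => [z| |]//; rewrite !lee_fin => zle zge.
have nR : 0 < n%:R :> R by rewrite ltr0n.
have z0 : 0 < z by apply: lt_le_trans zge; rewrite divr_gt0 ?expR_gt0.
exists (n%:R^-1 * ln z); first by rewrite lne_EFin.
set c := expR 1 / _ in zle *.
have c0 : 0 <= c.
  by rewrite divr_ge0 ?expR_ge0// subr_ge0 expR_le1 oppr_le0 ler01.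
have l4 : 0 <= ln 4 :> R by rewrite ln_ge0// ler1n.
have lc : 0 <= ln (1 + c) by rewrite ln_ge0// lerDl.
have c1 : 0 < 1 + c by lra.
have lnzle : ln z <= n%:R * (m + ln eta) + m0%:R + ln (1 + c).
  rewrite -ler_expR lnK ?posrE// !expRD lnK ?posrE// (le_trans zle)//.
  rewrite -mulrA ler_pM2l ?expR_gt0// mulrDr mulr1 lerD2l ler_peMl//.
  by rewrite -expR0 ler_expR.
have lnzge : n%:R * (m + ln eta) - m0%:R - M * (n%:R * (4 * g)) - ln 4 <= ln z.
  by rewrite -ler_expR lnK ?posrE// expRB lnK ?posrE.
have -> : n%:R^-1 * ln z - (m + ln eta) =
    n%:R^-1 * (ln z - n%:R * (m + ln eta)).
  by rewrite mulrBr mulrA mulVf ?gt_eqF// mul1r.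
rewrite normrM gtr0_norm ?invr_gt0// ler_pdivrMl// [leRHS]mulrDr.
rewrite (mulrC n%:R (_ / _)) divfK ?gt_eqF//.
rewrite ler_norml; apply/andP; split; last first.
  have : 0 <= n%:R * (M * (4 * g)) by rewrite !mulr_ge0// ltW.
  by lra.
have -> : n%:R * (M * (4 * g)) = M * (n%:R * (4 * g)) by ring.
by lra.
Qed.

End FixedSize.

(** * Asymptotics *)

Lemma cvg_natr_powRN (R : realType) (s : R) : 0 < s ->
  (n%:R `^ (- s) : R) @[n --> \oo] --> 0.
Proof.
move=> s0; apply/cvgr0Pnorm_lt => e e0; near=> n.
have n0 : 0 < n%:R :> R by rewrite ltr0n; near: n; exists 1%N.
rewrite ger0_norm ?powR_ge0// powRN -[ltRHS]invrK ltf_pV2 ?posrE ?invr_gt0 ?powR_gt0//.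
have -> : e^-1 = (e^-1 `^ s^-1) `^ s.
  by rewrite -powRrM mulVf ?gt_eqF// powRr1// invr_ge0 ltW.
rewrite gt0_ltr_powR// ?nnegrE ?powR_ge0 ?ler0n//.
near: n; exact: nbhs_infty_gtr.
Unshelve. all: by end_near. Qed.

Lemma gt0_powRD (R : realType) (x r s : R) : 0 < x ->
  x `^ (r + s) = x `^ r * x `^ s.
Proof. by move=> x0; rewrite powRD// lt0r_neq0 ?implybT. Qed.

(** With d = min (e, 1) and u = t x^(-a) >= 1, both terms of the minimum are at least
    u^(1 + d). Since t >= x^(1/2), the factor u^d exceeds x^((1/2 - a) d), and for
    a <= d / 16 this absorbs the losses x^(-a) and x^(- d / 8) with x^(d / 4) to
    spare. *)
Lemma tail_exponent (R : realType) (c e a x t : R) : 1 <= x -> 0 < c -> 0 < e ->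
  0 < a -> a <= Num.min e 1 / 16 -> 2 <= c * x `^ (Num.min e 1 / 4) ->
  x `^ (2^-1) <= t ->
  2 * t <= c / x `^ (Num.min e 1 / 8) *
    Num.min ((t * x `^ (- a)) ^+ 2) ((t * x `^ (- a)) `^ (1 + e)).
Proof.
set d := Num.min e 1 => x1 c0 e0 a0 ad cx xt.
have d0 : 0 < d by rewrite lt_min e0 ltr01.
have d1 : d <= 1 by rewrite ge_min lexx orbT.
have de : d <= e by rewrite ge_min lexx.
have x0 : 0 < x by exact: lt_le_trans x1.
have t0 : 0 < t by apply: lt_le_trans xt; rewrite powR_gt0.
set u := t * x `^ (- a).
have xu : x `^ (2^-1 - a) <= u.
  rewrite gt0_powRD//.
  by rewrite ler_pM2r ?powR_gt0.
have u1 : 1 <= u.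
  by apply: le_trans xu; rewrite -[leLHS](powRr0 x) ler_powR//; lra.
have u0 : 0 <= u by exact: le_trans u1.
apply: (@le_trans _ _ (c / x `^ (d / 8) * u `^ (1 + d))); last first.
  rewrite ler_wpM2l ?divr_ge0 ?powR_ge0 ?(ltW c0)// le_min; apply/andP; split.
    by rewrite -(powR_mulrn 2 u0) ler_powR//; lra.
  by rewrite ler_powR//; lra.
have uE : u `^ (1 + d) = u * u `^ d.
  by rewrite gt0_powRD ?powRr1// (lt_le_trans _ u1).
apply: (@le_trans _ _ (c / x `^ (d / 8) * (u * x `^ ((2^-1 - a) * d)))); last first.
  rewrite uE ler_wpM2l ?divr_ge0 ?powR_ge0 ?(ltW c0)// ler_wpM2l// powRrM.
  by rewrite ge0_ler_powR ?nnegrE ?powR_ge0// (ltW d0).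
have -> : c / x `^ (d / 8) * (u * x `^ ((2^-1 - a) * d)) =
    t * (c * x `^ (- (d / 8) - a + (2^-1 - a) * d)).
  rewrite (gt0_powRD (- (d / 8) - a) _ x0) (gt0_powRD (- (d / 8)) _ x0).
  rewrite (powRN _ (d / 8)) /u.
  by ring.
rewrite mulrC ler_pM2l// (le_trans cx)// ler_pM2l// ler_powR//.
have : a * d <= a by rewrite ler_piMr// ltW.
by lra.
Qed.

(** The size N enters through the cut-off eta = N^(-a), the concentration exponent
    min (e0, 1) / 8, and the gap exponent, which is half the decay exponent of the
    expected fraction of eigenvalues in [-eta, eta]. *)
Section Rate.
Variables (R : realType) (kappa e0 c C p a : R).
Hypothesis kappa0 : 0 < kappa.
Hypothesis e00 : 0 < e0.
Hypothesis c0 : 0 < c.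
Hypothesis C0 : 0 <= C.
Hypothesis p0 : 0 < p.
Hypothesis a0 : 0 < a.
Hypothesis ae : a <= Num.min e0 1 / 16.
Hypothesis ak : a <= kappa / 2.

(** The expected fraction of eigenvalues in [-eta, eta] has a contribution eta^p from
    the mass of mu and a contribution N^(-kappa) / eta from the Wasserstein
    distance. *)
Definition decay_exp := Num.min (a * p) (kappa - a).
Local Notation q := decay_exp.
Local Notation zeta := (Num.min e0 1 / 8).

Lemma decay_exp_gt0 : 0 < decay_exp.
Proof.
by rewrite lt_min mulr_gt0//=; move: ak kappa0; lra.
Qed.

(** In order: the scale sqrt N of the fluctuations divided by N; the constants lost
    in rounding that scale and in the two bounds of the expected determinant; the
    gap exponent times the fraction of eigenvalues near the origin; the Wasserstein
    error; the deficit of the truncated logarithm. *)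
Definition rate (x : R) : R :=
  x `^ (- 2^-1) + (1 + (ln 4 + ln (1 + expR 1 / (1 - expR (- 1))))) * x `^ (- 1) +
  4 * (2 * C * 2 `^ p + 1) * x `^ (- (q / 2)) + x `^ (- q) +
  ln 2 * C / (1 - 2 `^ (- p)) * x `^ (- (a * p)).

Lemma cvg_rate : rate n%:R @[n --> \oo] --> 0.
Proof.
have q0 := decay_exp_gt0.
suff : rate n%:R @[n --> \oo] --> 0 +
    (1 + (ln 4 + ln (1 + expR 1 / (1 - expR (- 1))))) * 0 +
    4 * (2 * C * 2 `^ p + 1) * 0 + 0 + ln 2 * C / (1 - 2 `^ (- p)) * 0.
  by rewrite !mulr0 !addr0.
have cvgN s : 0 < s -> (n%:R `^ (- s) : R) @[n --> \oo] --> 0 by exact: cvg_natr_powRN.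
do ![apply: cvgD]; do ?apply: cvgMl_tmp; apply: cvgN;
  by rewrite ?invr_gt0 ?divr_gt0 ?mulr_gt0.
Qed.

Variables (d : measure_display) (T : measurableType d).
Variables (P : probability T R) (n : nat) (H : T -> 'M[R]_n).
Hypothesis mH : forall i j, measurable_fun [set: T] (fun w => H w i j).
Hypothesis symH : forall w, (H w)^T = H w.
Hypothesis n0 : (0 < n)%N.
Variables (mu : probability (measurableTypeR R) R) (K : set R).
Hypothesis cK : compact K.
Hypothesis muK : mu (~` K) = 0%E.
Hypothesis W1mu : (W1 (mean_esd P H) mu <= (n%:R `^ (- kappa))%:E)%E.
Hypothesis muC : forall s, 0 < s -> s <= 2 * n%:R `^ (- a) ->
  (mu (sym_itv s) <= (C * s `^ p)%:E)%E.
Hypothesis conc : forall (g : R -> R) (delta : R),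
  (lip_norm g < +oo)%E -> 0 < delta ->
  (P [set w |
      delta%:E < `| (n%:R^-1 * \tr (fun_mx g (H w)))%:E -
                    (n%:R^-1)%:E * 'E_P[fun w' => \tr (fun_mx g (H w'))] |]
   <= (expR (- (c / n%:R `^ zeta) *
         Num.min ((n%:R * delta / fine (lip_norm g)) ^+ 2)
                 ((n%:R * delta / fine (lip_norm g)) `^ (1 + e0))))%:E)%E.
Hypothesis cn : 2 <= c * n%:R `^ (Num.min e0 1 / 4).
Hypothesis gap : ((3 / 4)%:E <= P [set w | forall x,
  (- expR (- (n%:R `^ (q / 2))) <= x <= expR (- (n%:R `^ (q / 2))))%R ->
  ~~ eigenvalue (H w) x])%E.

Lemma determinant_rate : exists y j : R,
  [/\ ((n%:R^-1)%:E * lne 'E_P[fun w => (`| \det (H w) |)%R])%E = y%:E,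
      (\int[mu]_x lne `|x|%:E)%E = j%:E & `|y - j| <= rate n%:R].
Proof.
set x : R := n%:R; have x1 : 1 <= x by rewrite ler1n.
have x0 : 0 < x by exact: lt_le_trans x1.
pose eta := x `^ (- a).
have eta0 : 0 < eta by exact: powR_gt0.
have eta1 : eta <= 1 by rewrite -(powRr0 x) ler_powR// oppr_le0 ltW.
have etaV : eta^-1 = x `^ a by rewrite /eta powRN invrK.
have einv0 : 0 < eta^-1 by rewrite invr_gt0.
have errE : eta^-1 * x `^ (- kappa) = x `^ (- (kappa - a)).
  rewrite etaV -gt0_powRD//.
  by congr (_ `^ _); lra.
have q0 := decay_exp_gt0.
have errq : x `^ (- (kappa - a)) <= x `^ (- q).
  by rewrite ler_powR// lerN2 ge_min lexx orbT.
have apq : x `^ (- (a * p)) <= x `^ (- q).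
  by rewrite ler_powR// lerN2 ge_min lexx.
have etap : eta `^ p = x `^ (- (a * p)) by rewrite -powRrM mulNr.
have Foo := lipschitz_integral_lty cK muK (log_plus_ge0 eta) (log_plus_lip eta0).
have muC1 s : 0 < s -> s <= eta -> (mu (sym_itv s) <= (C * s `^ p)%:E)%E.
  by move=> s0 se; apply: muC => //; rewrite (le_trans se)// -/x -/eta; lra.
have [j [b [jE bE jb]]] := integral_lne_norm p0 eta0 C0 muC1 Foo.
have [] := lipschitz_stat_W1 mH symH (log_plus_ge0 eta) einv0 (log_plus_lip eta0) W1mu Foo.
rewrite bE -/x errE.
have : (0 <= \int[P]_w (n%:R^-1 * \tr (fun_mx (log_plus eta) (H w)))%:E)%E.
  apply: integral_ge0 => w _; rewrite lee_fin mulr_ge0 ?invr_ge0//.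
  by apply: trace_fun_mx_ge0 => // z; exact: log_plus_ge0.
case mE : (\int[P]_w (_ * \tr (fun_mx (log_plus eta) _))%:E)%E => [m| |]// _.
rewrite -!EFinD !lee_fin => mb bm.
have Goo := lipschitz_integral_lty cK muK (tent_ge0 eta) (tent_lip eta0).
have [] := lipschitz_stat_W1 mH symH (tent_ge0 eta) einv0 (tent_lip eta0) W1mu Goo.
rewrite -/x errE => Gmu _.
have Gle : (\int[mu]_z (tent eta z)%:E <= (2 * (C * (2 * eta) `^ p))%:E)%E.
  apply: (@le_trans _ _ (2%:E * mu (sym_itv (2 * eta)))%E).
    rewrite -[X in mu X]setIT -integral_indic//.
    have mI : measurable_fun setT (\1_(sym_itv (2 * eta)) : measurableTypeR R -> R).
      by apply: measurable_indic; exact: measurable_sym_itv.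
    rewrite -ge0_integralZl_EFin//; last exact/measurable_EFinP.
    apply: ge0_le_integral => //.
    - by move=> z _; rewrite lee_fin tent_ge0.
    - by apply/measurable_EFinP; exact: lipschitz_measurable (tent_lip eta0).
    - by apply/measurable_EFinP; apply: measurable_funM.
    by move=> z _; rewrite -EFinM lee_fin; exact: tent_le_indic.
  rewrite EFinM; apply: lee_wpmul2l; first by rewrite lee_fin.
  by apply: muC; rewrite ?mulr_gt0.
pose g := (2 * C * 2 `^ p + 1) * x `^ (- q).
have g0 : 0 < g.
  by rewrite mulr_gt0 ?powR_gt0// ltr_wpDl// !mulr_ge0 ?powR_ge0.
have Gg : (\int[P]_w (n%:R^-1 * \tr (fun_mx (tent eta) (H w)))%:E <= g%:E)%E.
  apply: (le_trans Gmu); apply: (@le_trans _ _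
    ((2 * (C * (2 * eta) `^ p))%:E + (x `^ (- (kappa - a)))%:E)%E).
    by rewrite leeD2r.
  rewrite -EFinD lee_fin /g [leRHS]mulrDl mul1r lerD// powRM ?(ltW eta0)// etap.
  by rewrite !mulrA ler_wpM2l// !mulr_ge0 ?powR_ge0.
(* m0 is the least integer above sqrt N, where the tail bound takes effect. *)
pose m0 := (Num.truncn (x `^ 2^-1)).+1.
have m0x : x `^ 2^-1 <= m0%:R by rewrite ltW// truncnS_gt.
have m0le : m0%:R <= x `^ 2^-1 + 1.
  by rewrite /m0 -natr1 lerD2r truncn_le// powR_ge0.
have tail t : m0%:R <= t ->
    (P [set w | (t < `|\tr (fun_mx (log_plus eta) (H w)) - n%:R * m|)%R ] <=
    (expR (- (2 * t)))%:E)%E.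
  move=> m0t.
  have t0 : 0 < t by rewrite (lt_le_trans _ m0t)// ltr0n.
  have K0 : 0 <= c / n%:R `^ zeta by rewrite divr_ge0 ?powR_ge0// ltW.
  have F2 : log_plus eta 0 != log_plus eta (2 * eta).
    rewrite log_plus_small ?normr0 ?ltW// log_plus_large//; last first.
      by rewrite gtr0_norm ?mulr_gt0//; lra.
    rewrite gtr0_norm ?mulr_gt0// lnM ?posrE// addrK eq_sym gt_eqF//.
    by rewrite ln_gt0// ltr1n.
  apply: le_trans (lipschitz_stat_tail mH symH (log_plus_ge0 eta) einv0
    (log_plus_lip eta0) n0 K0 (ltW e00) F2 t0 conc mE) _.
  rewrite lee_fin ler_expR lerN2 invrK.
  by apply: tail_exponent => //; exact: le_trans m0t.
have [] := log_expected_det mH symH n0 eta0 tail (powR_ge0 _ _) g0 eta1 _ Gg gap => //.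
move=> y yE yle; exists y, j; split=> //.
(* Compare through the expected and the integrated truncated logarithm. *)
have -> : y - j = (y - (m + ln eta)) + (m - b) + (b + ln eta - j) by lra.
have mble : `|m - b| <= x `^ (- q) by rewrite ler_norml; lra.
have jble : `|b + ln eta - j| <=
    ln 2 * C / (1 - 2 `^ (- p)) * x `^ (- (a * p)).
  by case/andP: jb => j0 j1; rewrite ger0_norm// -etap.
rewrite (le_trans (ler_normD _ _))// /rate lerD//.
rewrite (le_trans (ler_normD _ _))// lerD//.
rewrite (le_trans yle)//.
have -> : x `^ (q / 2) * (4 * g) = 4 * (2 * C * 2 `^ p + 1) * x `^ (- (q / 2)).
  rewrite /g (_ : - (q / 2) = q / 2 + - q); last by lra.
  rewrite gt0_powRD//.
  by ring.
rewrite lerD2r -/x; set c3 := ln 4 + _.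
apply: (@le_trans _ _ ((x `^ 2^-1 + 1 + c3) / x)).
  by rewrite ler_pM2r ?invr_gt0// lerD2r.
have xV : x `^ (- 1) = x^-1 by rewrite powR_inv1// ltW.
have xh : x `^ (- 2^-1) = x `^ 2^-1 / x.
  rewrite -xV -gt0_powRD//.
  by congr (_ `^ _); lra.
by rewrite xh xV le_eqVlt; apply/orP; left; apply/eqP; ring.
Qed.

End Rate.

Unset Implicit Arguments.

Theorem theorem1p2 (R : realType) (kappa : R) (kappa_gt0 : 0 < kappa)
  (d : nat -> measure_display) (Omega : forall N : nat, measurableType (d N))
  (P : forall N : nat, probability (Omega N) R)
  (H : forall N : nat, Omega N -> 'M[R]_N)
  (H_meas : forall (N : nat) (i j : 'I_N),
    measurable_fun [set: Omega N] (fun w => H N w i j))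
  (H_sym : forall (N : nat) (w : Omega N), (H N w)^T = H N w)
  (mu : nat -> probability (measurableTypeR R) R)
  (W_dist : forall N : nat, (0 < N)%N ->
    (W1 (mean_esd (P N) (H N)) (mu N) <= (N%:R `^ (- kappa))%:E)%E)
  (W_supp : exists2 K : set R, compact K &
    forall N : nat, (0 < N)%N -> mu N (~` K) = 0%E)
  (W_dens : forall N : nat, (0 < N)%N -> exists g : R -> R,
    [/\ measurable_fun `]- kappa, kappa[ g,
        (forall x : R, `|x| < kappa -> 0 <= g x),
        (forall A : set (measurableTypeR R), measurable A ->
           A `<=` `]- kappa, kappa[ ->
           mu N A = (\int[lebesgue_measure]_(x in A) (g x)%:E)%E) &
        (forall x : R, 0 < `|x| -> `|x| < kappa ->
           g x < kappa^-1 * `|x| `^ (-1 + kappa))])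
  (L : exists2 eps0 : R, 0 < eps0 &
    forall zeta : R, 0 < zeta -> exists2 c : R, 0 < c &
    forall (N : nat) (f : R -> R) (delta : R),
      (0 < N)%N -> (lip_norm f < +oo)%E -> 0 < delta ->
      (P N [set w |
          delta%:E < `| (N%:R^-1 * \tr (fun_mx f (H N w)))%:E -
                        (N%:R^-1)%:E *
                          'E_(P N)[fun w' => \tr (fun_mx f (H N w'))] |]
       <= (expR (- (c / N%:R `^ zeta) *
             Num.min ((N%:R * delta / fine (lip_norm f)) ^+ 2)
                     ((N%:R * delta / fine (lip_norm f)) `^ (1 + eps0))))%:E)%E)
  (Gap : forall eps : R, 0 < eps ->
    P N [set w | forall x : R,
            - expR (- (N%:R `^ eps)) <= x <= expR (- (N%:R `^ eps)) ->
            ~~ eigenvalue (H N w) x] @[N --> \oo] --> 1%E) :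
  ((N%:R^-1)%:E * lne 'E_(P N)[fun w => (`| \det (H N w) |)%R]
    - \int[mu N]_x lne (`|x|%R)%:E)%E @[N --> \oo] --> 0%E.

Proof.
have [K cK muK] := W_supp; have [e0 e00 {}L] := L.
pose p := Num.min kappa 1; pose a := Num.min (Num.min e0 1 / 16) (kappa / 2).
have d0 : 0 < Num.min e0 1 by rewrite lt_min e00 ltr01.
have p0 : 0 < p by rewrite lt_min kappa_gt0 ltr01.
have a0 : 0 < a by rewrite lt_min !divr_gt0.
have ae : a <= Num.min e0 1 / 16 by rewrite ge_min lexx.
have ak : a <= kappa / 2 by rewrite ge_min lexx orbT.
have [c c0 Lc] := L (Num.min e0 1 / 8) (divr_gt0 d0 (ltr0n _ 8)).
pose C := 4 * kappa^-1 * 2 `^ (- p) / (1 - 2 `^ (- p)).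
have C0 : 0 <= C.
  have /andP[_ q1] := powR2N_itv p0.
  by rewrite !mulr_ge0 ?powR_ge0 ?invr_ge0 ?(ltW kappa_gt0)// subr_ge0 ltW.
have q0 := decay_exp_gt0 kappa_gt0 p0 a0 ak.
have cvgN s : 0 < s -> (n%:R `^ (- s) : R) @[n --> \oo] --> 0 by exact: cvg_natr_powRN.
(* 3/4 leaves room for the two events of probability 1/4 in the lower bound. *)
have gap : \forall N \near \oo, ((3 / 4)%:E <= P N [set w | forall x : R,
    (- expR (- (N%:R `^ (decay_exp kappa p a / 2))) <= x <=
       expR (- (N%:R `^ (decay_exp kappa p a / 2))))%R ->
    ~~ eigenvalue (H N w) x])%E.
  have /fine_cvgP[fin cvg1] := Gap _ (divr_gt0 q0 (ltr0n _ 2)).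
  have lt1 : 3 / 4 < 1 :> R by lra.
  have gt34 := cvgr_gt _ cvg1 _ lt1.
  near=> N; rewrite -[leRHS]fineK; last by near: N.
  by rewrite lee_fin ltW//; near: N; exact: gt34.
have key : \forall N \near \oo, exists y j : R,
    [/\ ((N%:R^-1)%:E * lne 'E_(P N)[fun w => (`| \det (H N w) |)%R])%E = y%:E,
        (\int[mu N]_x lne (`|x|%R)%:E)%E = j%:E &
        `|y - j| <= rate kappa C p a N%:R].
  near=> N.
  have N0 : (0 < N)%N by near: N; exists 1%N.
  have x0 : 0 < N%:R :> R by rewrite ltr0n.
  have ball s : 0 < s -> s <= 2 * N%:R `^ (- a) ->
      (mu N (sym_itv s) <= (C * s `^ p)%:E)%E.
    move=> s0 sN; have [g [mg g0 gE gk]] := W_dens N N0.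
    have sr : s <= Num.min kappa 1.
      apply: (le_trans sN); rewrite -ler_pdivlMl//; apply: ltW.
      near: N; have r0 : 0 < 2^-1 * Num.min kappa 1 by rewrite mulr_gt0.
      exact: (cvgr_lt _ (cvgN a a0) _ r0).
    move: sr; rewrite le_min => /andP[sk s1].
    by apply: (density_ball kappa_gt0 p0 _ _ s0 sk s1 mg g0 gE gk);
      rewrite ge_min lexx ?orbT.
  apply: (determinant_rate kappa_gt0 e00 c0 C0 p0 a0 ae ak (H_meas N) (H_sym N)
    N0 cK (muK N N0) (W_dist N N0) ball (fun g delta => Lc N g delta N0)).
  - have -> : 2 = c * (c / 2)^-1 by rewrite invf_div mulrCA mulfV ?mulr1// gt_eqF.
    rewrite ler_pM2l// -[leRHS]invrK -powRN lef_pV2 ?posrE ?divr_gt0 ?powR_gt0//.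
    apply: ltW; near: N; have r0 : 0 < c / 2 by rewrite divr_gt0.
    exact: (cvgr_lt _ (cvgN _ (divr_gt0 d0 (ltr0n _ 4))) _ r0).
  - by near: N.
apply/fine_cvgP; split.
  by apply: filterS key => N [y [j [-> -> _]]].
have cr := cvg_rate C kappa_gt0 p0 a0 ak.
apply/cvgr0Pnorm_lt => e e_gt0; near=> N.
have [y [j [yE jE yj]]] : exists y j : R,
    [/\ ((N%:R^-1)%:E * lne 'E_(P N)[fun w => (`| \det (H N w) |)%R])%E = y%:E,
        (\int[mu N]_x lne (`|x|%R)%:E)%E = j%:E &
        `|y - j| <= rate kappa C p a N%:R] by near: N.
rewrite /= yE jE /= (le_lt_trans yj)//.
by near: N; exact: (cvgr_lt _ cr _ e_gt0).
Unshelve. all: by end_near. Qed.
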